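(* The category $\mathbf{LeibDer2}$ of LeibDer2 pairs (Leibniz 2-algebras with a 2-derivation) and the category $\mathbf{2LeibDer}_\infty$ of $2\mathrm{LeibDer}_\infty$ pairs (2-term sh Leibniz algebras with a homotopy derivation) are equivalent.
   Context: All vector spaces and linear maps are over a field $\mathbb{K}$ of characteristic zero. **The category $\mathbf{2LeibDer}_\infty$.** A 2-term sh Leibniz algebra $(A_1\xrightarrow{d}A_0,l_2,l_3)$ is a chain complex $A_1\xrightarrow{d}A_0$ with bilinear maps $l_2:A_i\times A_j\to A_{i+j}$ ($0\le i,j,i+j\le1$) and a trilinear map $l_3:A_0\times A_0\times A_0\to A_1$ such that for $x,y,z,w\in A_0$, $m,n\in A_1$: - $dl_2(x,m)=l_2(x,dm)$, $dl_2(m,x)=l_2(dm,x)$, $l_2(dm,n)=l_2(m,dn)$; - $-dl_3(x,y,z)=l_2(l_2(x,y),z)-l_2(l_2(x,z),y)-l_2(x,l_2(y,z))$; - $-l_3(x,y,dm)=l_2(l_2(x,y),m)-l_2(l_2(x,m),y)-l_2(x,l_2(y,m))$; - $-l_3(x,dm,y)=l_2(l_2(x,m),y)-l_2(l_2(x,y),m)-l_2(x,l_2(m,y))$; - $-l_3(dm,x,y)=l_2(l_2(m,x),y)-l_2(l_2(m,y),x)-l_2(m,l_2(x,y))$; - $l_2(x,l_3(y,z,w))+l_2(l_3(x,z,w),y)-l_2(l_3(x,y,w),z)+l_2(l_3(x,y,z),w)=l_3(l_2(x,y),z,w)-l_3(l_2(x,z),y,w)+l_3(l_2(x,w),y,z)-l_3(x,l_2(y,z),w)+l_3(x,l_2(y,w),z)+l_3(x,y,l_2(z,w))$.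 A morphism of 2-term sh Leibniz algebras $(A_1\xrightarrow{d}A_0,l_2,l_3)\to(A'_1\xrightarrow{d'}A'_0,l'_2,l'_3)$ is a triple $(f_0,f_1,f_2)$: linear maps $f_0:A_0\to A'_0$, $f_1:A_1\to A'_1$ with $d'\circ f_1=f_0\circ d$ and a bilinear map $f_2:A_0\times A_0\to A'_1$ with - $d'f_2(x,y)=f_0(l_2(x,y))-l'_2(f_0(x),f_0(y))$; - $f_2(x,dm)=f_1(l_2(x,m))-l'_2(f_0(x),f_1(m))$; $f_2(dm,x)=f_1(l_2(m,x))-l'_2(f_1(m),f_0(x))$; - $f_1(l_3(x,y,z))+l'_2(f_2(x,y),f_0(z))-l'_2(f_2(x,z),f_0(y))-l'_2(f_0(x),f_2(y,z))+f_2(l_2(x,y),z)-f_2(l_2(x,z),y)-f_2(x,l_2(y,z))-l'_3(f_0(x),f_0(y),f_0(z))=0$. A homotopy derivation on $(A_1\xrightarrow{d}A_0,l_2,l_3)$ is a triple $(\theta_0,\theta_1,\theta_2)$: linear $\theta_0:A_0\to A_0$, $\theta_1:A_1\to A_1$ with $d\circ\theta_1=\theta_0\circ d$, and bilinear $\theta_2:A_0\times A_0\to A_1$ with - $d\theta_2(x,y)=\theta_0(l_2(x,y))-l_2(\theta_0(x),y)-l_2(x,\theta_0(y))$; - $\theta_2(x,dm)=\theta_1(l_2(x,m))-l_2(\theta_0(x),m)-l_2(x,\theta_1(m))$; - $\theta_2(dm,x)=\theta_1(l_2(m,x))-l_2(\theta_1(m),x)-l_2(m,\theta_0(x))$; -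 $l_3(\theta_0(x),y,z)+l_3(x,\theta_0(y),z)+l_3(x,y,\theta_0(z))-\theta_1l_3(x,y,z)=l_2(\theta_2(x,y),z)-l_2(\theta_2(x,z),y)-l_2(x,\theta_2(y,z))+\theta_2(l_2(x,y),z)-\theta_2(l_2(x,z),y)-\theta_2(x,l_2(y,z))$. A 2-term sh Leibniz algebra with a homotopy derivation is a $2\mathrm{LeibDer}_\infty$ pair. A morphism of $2\mathrm{LeibDer}_\infty$ pairs is a morphism $(f_0,f_1,f_2)$ of the underlying 2-term sh Leibniz algebras with a linear map $\mathcal{B}:A_0\to A'_1$ such that - $f_0(\theta_0(x))-\theta'_0(f_0(x))=d'(\mathcal{B}(x))$; $f_1(\theta_1(m))-\theta'_1(f_1(m))=\mathcal{B}(dm)$; - $f_1(\theta_2(x,y))-\theta'_2(f_0(x),f_0(y))=\theta'_1(f_2(x,y))-f_2(\theta_0(x),y)-f_2(x,\theta_0(y))+\mathcal{B}(l_2(x,y))-l'_2(\mathcal{B}(x),f_0(y))-l'_2(f_0(x),\mathcal{B}(y))$. The composite of $(f_0,f_1,f_2,\mathcal{B})$ followed by $(g_0,g_1,g_2,\mathcal{C})$ is $(g_0f_0,\ g_1f_1,\ g_2(f_0\cdot,f_0\cdot)+g_1f_2,\ \mathcal{C}f_0+g_1\mathcal{B})$. **The category $\mathbf{LeibDer2}$.** A 2-vector space $\mathbb{V}=(V_1\rightrightarrows V_0)$ is a category internal to the category of vector spaces (vector spaces of objects $V_0$ and morphisms $V_1$, all structure maps linear). Linear (bilinear) functors are functors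 which are linear (bilinear) on objects and morphisms; the natural transformations below have components depending (multi)linearly on their arguments. Below, $1$ denotes identity morphisms. A Leibniz 2-algebra is a 2-vector space $\mathbb{V}$ with a bilinear functor $[\,,]:\mathbb{V}\times\mathbb{V}\to\mathbb{V}$ and a trilinear natural isomorphism $J_{x,y,z}:[[x,y],z]\to[[x,z],y]+[x,[y,z]]$ such that for all $x,y,z,w\in V_0$ the two composites from $[[[x,y],z],w]$ to $[[[x,w],z],y]+[[x,[z,w]],y]+[[x,z],[y,w]]+[[x,w],[y,z]]+[x,[[y,w],z]]+[x,[y,[z,w]]]$ coincide: the first is $[J_{x,y,z},1_w]$, then $J_{[x,z],y,w}+J_{x,[y,z],w}$, then $[J_{x,z,w},1_y]+1+1+[1_x,J_{y,z,w}]$; the second is $J_{[x,y],z,w}$, then $[J_{x,y,w},1_z]+1$, then $J_{[x,w],y,z}+J_{x,[y,w],z}+J_{x,y,[z,w]}$. A morphism of Leibniz 2-algebras $(\mathbb{V},[\,,],J)\to(\mathbb{V}',[\,,]',J')$ is a linear functor $F=(F_0,F_1):\mathbb{V}\to\mathbb{V}'$ with a natural transformation $F_2(x,y):[F_0(x),F_0(y)]'\to F_0[x,y]$ such that the composites from $[[F_0(x),F_0(y)]',F_0(z)]'$ to $F_0([[x,z],y]+[x,[y,z]])$ coincide: $J'$, then $[F_2(x,z),1]'+[1,F_2(y,z)]'$, then $F_2([x,z],y)+F_2(x,[y,z])$; versus $[F_2(x,y),1]'$, then $F_2([x,y],z)$, then $F(J_{x,y,z})$. A 2-derivation on $(\mathbb{V},[\,,],J)$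 is a linear functor $D:\mathbb{V}\to\mathbb{V}$ with a natural isomorphism $\mathcal{D}_{x,y}:D[x,y]\to[Dx,y]+[x,Dy]$ such that the composites from $D[[x,y],z]$ to $[[Dx,z],y]+[[x,Dz],y]+[[x,z],Dy]+[Dx,[y,z]]+[x,[Dy,z]]+[x,[y,Dz]]$ coincide: $D(J_{x,y,z})$, then $\mathcal{D}_{[x,z],y}+\mathcal{D}_{x,[y,z]}$, then $[\mathcal{D}_{x,z},1]+1+1+[1,\mathcal{D}_{y,z}]$; versus $\mathcal{D}_{[x,y],z}$, then $[\mathcal{D}_{x,y},1]+1$, then $J_{Dx,y,z}+J_{x,Dy,z}+J_{x,y,Dz}$. A Leibniz 2-algebra with a 2-derivation is a LeibDer2 pair. A morphism of LeibDer2 pairs $(\mathbb{V},[\,,],J,D,\mathcal{D})\to(\mathbb{V}',[\,,]',J',D',\mathcal{D}')$ is a Leibniz 2-algebra morphism $(F=(F_0,F_1),F_2)$ with a natural isomorphism $\Phi_x:D'(F_0(x))\to F_0(D(x))$ such that the composites from $D'([F_0(x),F_0(y)]')$ to $F_0([Dx,y]+[x,Dy])$ coincide: $D'(F_2(x,y))$, then $\Phi_{[x,y]}$, then $F(\mathcal{D}_{x,y})$; versus $\mathcal{D}'_{F_0(x),F_0(y)}$, then $[\Phi_x,1]'+[1,\Phi_y]'$, then $F_2(Dx,y)+F_2(x,Dy)$. The composite of $(F,F_2,\Phi)$ followed by $(G,G_2,\Psi)$ is the functor $G\circ F$ with the transformations $G(F_2(x,y))\circ G_2(F_0x,F_0y)$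 and $G(\Phi_x)\circ\Psi_{F_0x}$. *)

(* Defs.v *)
From HB Require Import structures.
From mathcomp Require Import all_boot all_order all_algebra.
From mathcomp Require Import boolp.

Set Implicit Arguments.
Unset Strict Implicit.
Unset Printing Implicit Defensive.

Import GRing.Theory.
Local Open Scope ring_scope.

Record category := Category {
  Ob :> Type;
  Hom : Ob -> Ob -> Type;
  idm : forall a, Hom a a;
  (* diagrammatic order: [compm f g] is f followed by g *)
  compm : forall a b c, Hom a b -> Hom b c -> Hom a c;
  compm1l : forall a b (f : Hom a b), compm (idm a) f = f;
  compm1r : forall a b (f : Hom a b), compm f (idm b) = f;
  compmA : forall a b c d (f : Hom a b) (g : Hom b c) (h : Hom c d),
    compm f (compm g h) = compm (compm f g) h
}.
Arguments Hom {C} a b : rename.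
Arguments idm {C} a : rename.
Arguments compm {C a b c} f g : rename.

Record functor (C D : category) := Functor {
  fob :> C -> D;
  fhom : forall a b, Hom a b -> Hom (fob a) (fob b);
  fhom1 : forall a, fhom (idm a) = idm (fob a);
  fhomM : forall a b c (f : Hom a b) (g : Hom b c),
    fhom (compm f g) = compm (fhom f) (fhom g)
}.
Arguments fhom {C D} F {a b} f : rename.

Definition id_functor (C : category) : functor C C :=
  @Functor C C id (fun _ _ => id) (fun _ => erefl) (fun _ _ _ _ _ => erefl).

Definition comp_functor (C D E : category)
    (F : functor C D) (G : functor D E) : functor C E.
Proof.
exists (fun a => G (F a)) (fun a b f => fhom G (fhom F f)).
- by move=> a; rewrite !fhom1.
- by move=> a b c f g; rewrite !fhomM.
Defined.

Definition is_isom (C : category) (a b : C) (f : Hom a b) : Prop :=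
  exists g : Hom b a, compm f g = idm a /\ compm g f = idm b.

Definition naturally_isomorphic (C D : category) (F G : functor C D) : Prop :=
  exists eta : forall a : C, Hom (F a) (G a),
    (forall a b (f : Hom a b),
      compm (fhom F f) (eta b) = compm (eta a) (fhom G f)) /\
    (forall a, is_isom (eta a)).

Definition equivalent_categories (C D : category) : Prop :=
  exists (F : functor C D) (G : functor D C),
    naturally_isomorphic (id_functor C) (comp_functor F G) /\
    naturally_isomorphic (comp_functor G F) (id_functor D).

Section Multilinear.
Context (K : fieldType).

Definition trilinear (U V W X : lmodType K) (f : U -> V -> W -> X) : Prop :=
  [/\ forall v w, linear (fun u => f u v w),
      forall u w, linear (fun v => f u v w) &
      forall u v, linear (f u v)].

Lemma linear_ext (U V : lmodType K) (f g : {linear U -> V}) : f =1 g -> f = g.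
Proof.
case: f g => [f [[fa] [fs]]] [g [[ga] [gs]]] /= /funext efg.
case: g / efg ga gs => ga gs.
by rewrite (Prop_irrelevance fa ga) (Prop_irrelevance fs gs).
Qed.

Lemma bilinear_ext (U V W : lmodType K) (f g : {bilinear U -> V -> W}) :
  f =2 g -> f = g.
Proof.
case: f g => [f [[a b c d]]] [g [[a' b' c' d']]] /= efg.
have {}efg : f = g by apply: funext => x; apply: funext => y.
case: g / efg a' b' c' d' => a' b' c' d'.
rewrite (Prop_irrelevance a a') (Prop_irrelevance b b').
by rewrite (Prop_irrelevance c c') (Prop_irrelevance d d').
Qed.

Definition linear_pack (U V : lmodType K) (f : U -> V) (lf : linear f) :
    {linear U -> V} :=
  HB.pack f (GRing.isLinear.Build K U V *:%R f lf).

Definition bilinear_pack (U V W : lmodType K) (f : U -> V -> W)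
    (lf : forall v, linear (f^~ v)) (rf : forall u, linear (f u)) :
    {bilinear U -> V -> W} :=
  HB.pack f (bilinear_isBilinear.Build K U V W *:%R *:%R f (lf, rf)).

End Multilinear.

Section Pullback.
Context (K : fieldType) (V1 V0 : lmodType K) (s t : {linear V1 -> V0}).

Definition composable : {pred V1 * V1} := [pred p | t p.1 == s p.2].

Fact composable_submod_closed : submod_closed composable.
Proof.
split=> [|a p q]; rewrite !inE /= ?linear0 // => /eqP ep /eqP eq_.
by rewrite !linearP ep eq_.
Qed.
HB.instance Definition _ :=
  GRing.isSubmodClosed.Build K (V1 * V1)%type composable composable_submod_closed.

Record pullback := Pullback { pullback_val : V1 * V1; _ : pullback_val \in composable }.
HB.instance Definition _ := [isSub for pullback_val].
HB.instance Definition _ := [Choice of pullback by <:].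
HB.instance Definition _ := [SubChoice_isSubLmodule of pullback by <:].

End Pullback.

(* A decision procedure for identities in an abelian group, used to check that
   the morphisms below are closed under composition *)
Inductive zexp := ZZero | ZVar of nat | ZAdd of zexp & zexp | ZOpp of zexp.

Fixpoint zeval (V : zmodType) (env : seq V) (e : zexp) : V :=
  match e with
  | ZZero => 0
  | ZVar i => env`_i
  | ZAdd a b => zeval env a + zeval env b
  | ZOpp a => - zeval env a
  end.

Fixpoint zcoef (e : zexp) (i : nat) : int :=
  match e with
  | ZZero => 0
  | ZVar j => (i == j)%:Z
  | ZAdd a b => zcoef a i + zcoef b i
  | ZOpp a => - zcoef a i
  end.

Lemma zevalE (V : zmodType) (env : seq V) (e : zexp) :
  zeval env e = \sum_(i < size env) env`_i *~ zcoef e i.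
Proof.
elim: e => [|j|a IHa b IHb|a IHa] /=.
- by rewrite big1 // => i _; rewrite mulr0z.
- case: (ltnP j (size env)) => [lt_j|ge_j].
    rewrite (bigD1 (Ordinal lt_j)) //= eqxx mulr1z big1 ?addr0 // => i.
    by rewrite -val_eqE /= => /negPf->; rewrite mulr0z.
  rewrite nth_default // big1 // => i _.
  by rewrite ltn_eqF ?mulr0z // (leq_trans (ltn_ord i)).
- by rewrite IHa IHb -big_split; apply: eq_bigr => i _; rewrite mulrzDr.
- by rewrite IHa -sumrN; apply: eq_bigr => i _; rewrite mulrNz.
Qed.

Lemma zeval_eq (V : zmodType) (env : seq V) (a b : zexp) :
    all (fun i => zcoef a i == zcoef b i) (iota 0 (size env)) ->
  zeval env a = zeval env b.
Proof.
move=> /allP eq_ab; rewrite !zevalE; apply: eq_bigr => i _; congr (_ *~ _).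
by apply/eqP/eq_ab; rewrite mem_iota ltn_ord.
Qed.

Ltac zmod_index t env :=
  lazymatch env with
  | ?u :: ?env' =>
    match goal with
    | _ => let _ := match goal with _ => unify t u end in constr:(0%N)
    | _ => let n := zmod_index t env' in constr:(n.+1)
    end
  end.

Ltac zmod_env t env :=
  lazymatch t with
  | 0%R => env
  | (?a + ?b)%R => let env' := zmod_env a env in zmod_env b env'
  | (- ?a)%R => zmod_env a env
  | _ =>
    match env with
    | _ => let n := zmod_index t env in env
    | _ => constr:(t :: env)
    end
  end.

Ltac zmod_reify t env :=
  lazymatch t with
  | 0%R => constr:(ZZero)
  | (?a + ?b)%R =>
    let a' := zmod_reify a env in
    let b' := zmod_reify b env in constr:(ZAdd a' b')
  | (- ?a)%R => let a' := zmod_reify a env in constr:(ZOpp a')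
  | _ => let n := zmod_index t env in constr:(ZVar n)
  end.

Ltac zmod :=
  lazymatch goal with |- @eq ?T ?a ?b =>
    let env := zmod_env a (@nil T) in
    let env := zmod_env b env in
    let a' := zmod_reify a env in
    let b' := zmod_reify b env in
    exact: (@zeval_eq _ env a' b' isT)
  end.

Lemma zmod_comb (V : zmodType) (c d a b : V) : c = d -> a + d = b + c -> a = b.
Proof. by move=> -> /addIr. Qed.

Section TwoVect.
Context (K : fieldType).

(* Total version of a composition map, with junk value 0 on pairs that are not
   composable.  In every equation between composites below all the composites
   exist, by the source and target conditions imposed alongside. *)
Definition seq_comp (V1 V0 : lmodType K) (s t : {linear V1 -> V0})
    (c : pullback s t -> V1) (f g : V1) : V1 :=
  if insub (f, g) is Some p then c p else 0.

(* Category internal to K-vector spaces *)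
Record two_vect := TwoVect {
  tv_ob : lmodType K;
  tv_ar : lmodType K;
  src : {linear tv_ar -> tv_ob};
  tgt : {linear tv_ar -> tv_ob};
  idar : {linear tv_ob -> tv_ar};
  comp : {linear pullback src tgt -> tv_ar};
  src_idar : forall x, src (idar x) = x;
  tgt_idar : forall x, tgt (idar x) = x;
  src_compP : forall p, src (comp p) = src (val p).1;
  tgt_compP : forall p, tgt (comp p) = tgt (val p).2;
  seq_comp1l : forall f, seq_comp comp (idar (src f)) f = f;
  seq_comp1r : forall f, seq_comp comp f (idar (tgt f)) = f;
  seq_compA : forall f g h, tgt f = src g -> tgt g = src h ->
    seq_comp comp f (seq_comp comp g h) = seq_comp comp (seq_comp comp f g) h
}.

End TwoVect.

Arguments src {K V} : rename.
Arguments tgt {K V} : rename.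
Arguments comp {K V} : rename.
Arguments idar {K} V : rename.
Arguments seq_comp1l {K} V f : rename.
Arguments seq_comp1r {K} V f : rename.

Reserved Notation "f ;; g" (at level 45, left associativity).
Notation "f ;; g" := (seq_comp comp f g) : ring_scope.

Definition is_iso_ar (K : fieldType) (V : two_vect K) (f : tv_ar V) : Prop :=
  exists g : tv_ar V, [/\ src g = tgt f, tgt g = src f,
    f ;; g = idar V (src f) & g ;; f = idar V (tgt f)].

Section TwoVectTheory.
Context (K : fieldType) (V : two_vect K).
Implicit Types f g : tv_ar V.

Lemma seq_compP f g (fg : tgt f = src g) :
  exists p : pullback (@src K V) tgt, val p = (f, g) /\ f ;; g = comp p.
Proof.
have fg' : (f, g) \in composable (@src K V) tgt by rewrite inE /= fg.
exists (Pullback fg'); split=> //; rewrite /seq_comp insubT //=.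
Qed.

Lemma src_comp f g : tgt f = src g -> src (f ;; g) = src f.
Proof. by case/seq_compP=> p [pE ->]; rewrite src_compP pE. Qed.

Lemma tgt_comp f g : tgt f = src g -> tgt (f ;; g) = tgt g.
Proof. by case/seq_compP=> p [pE ->]; rewrite tgt_compP pE. Qed.

Lemma seq_compP_linear a f g f' g' : tgt f = src g -> tgt f' = src g' ->
  (a *: f + f') ;; (a *: g + g') = a *: (f ;; g) + f' ;; g'.
Proof.
move=> fg fg'; have fg2 : tgt (a *: f + f') = src (a *: g + g').
  by rewrite !linearP fg fg'.
have [p [pE ->]] := seq_compP fg; have [p' [pE' ->]] := seq_compP fg'.
have [q [qE ->]] := seq_compP fg2.
by rewrite -linearP; congr (comp _); apply: val_inj; rewrite qE /= pE pE'.
Qed.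

Lemma seq_compE f g : tgt f = src g -> f ;; g = f + g - idar V (tgt f).
Proof.
move=> fg; have e1 := seq_comp1r V f.
have := @seq_compP_linear 1 f (idar V (tgt f)) 0 (g - idar V (tgt f)).
rewrite !scale1r src_idar linear0 linearB src_idar /= fg subrr => /(_ erefl erefl).
rewrite addr0 addrC subrK => ->; rewrite -fg e1 -addrA; congr (_ + _).
have := seq_comp1l V (g - idar V (src g)).
by rewrite linearB src_idar subrr linear0 fg.
Qed.

End TwoVectTheory.

(* Kernel component of an arrow; an arrow is determined by its source and its
   kernel component, and composition adds kernel components *)
HB.lock Definition arr (K : fieldType) (V : two_vect K) (f : tv_ar V) : tv_ar V :=
  f - idar V (src f).

Section ArrTheory.
Context (K : fieldType) (V : two_vect K).
Implicit Types f g : tv_ar V.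

Lemma arrD f g : arr (f + g) = arr f + arr g.
Proof. by rewrite !arr.unlock !linearD /=; zmod. Qed.

Lemma arr_idar x : arr (idar V x) = 0.
Proof. by rewrite !arr.unlock src_idar subrr. Qed.

Lemma arr_comp f g : tgt f = src g -> arr (f ;; g) = arr f + arr g.
Proof. by move=> fg; rewrite !arr.unlock src_comp // seq_compE // fg; zmod. Qed.

Lemma arr_inj f g : src f = src g -> arr f = arr g -> f = g.
Proof. by rewrite !arr.unlock => -> /addIr. Qed.

Lemma is_iso_arT f : is_iso_ar f.
Proof.
pose g := idar V (src f) + idar V (tgt f) - f.
have sg : src g = tgt f by rewrite /g linearB linearD !src_idar /=; zmod.
have tg : tgt g = src f by rewrite /g linearB linearD !tgt_idar /=; zmod.
exists g; split=> //; rewrite seq_compE ?sg ?tg // /g; zmod.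
Qed.

End ArrTheory.

Section LinFunctor.
Context (K : fieldType).

Record lin_functor (V W : two_vect K) := LinFunctor {
  on_ob : {linear tv_ob V -> tv_ob W};
  on_ar : {linear tv_ar V -> tv_ar W};
  on_src : forall f, src (on_ar f) = on_ob (src f);
  on_tgt : forall f, tgt (on_ar f) = on_ob (tgt f);
  on_idar : forall x, on_ar (idar V x) = idar W (on_ob x);
  on_comp : forall f g, tgt f = src g -> on_ar (f ;; g) = on_ar f ;; on_ar g
}.

Definition lin_functor_id (V : two_vect K) : lin_functor V V :=
  @LinFunctor V V idfun idfun
    (fun _ => erefl) (fun _ => erefl) (fun _ => erefl) (fun _ _ _ => erefl).

Definition lin_functor_comp (U V W : two_vect K)
    (F : lin_functor U V) (G : lin_functor V W) : lin_functor U W.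
Proof.
exists (on_ob G \o on_ob F) (on_ar G \o on_ar F) => /=.
- by move=> f; rewrite !on_src.
- by move=> f; rewrite !on_tgt.
- by move=> x; rewrite !on_idar.
- by move=> f g fg; rewrite !on_comp ?on_tgt ?on_src ?fg.
Defined.

Record bilin_functor (V : two_vect K) := BilinFunctor {
  br_ob : {bilinear tv_ob V -> tv_ob V -> tv_ob V};
  br_ar : {bilinear tv_ar V -> tv_ar V -> tv_ar V};
  br_src : forall f g, src (br_ar f g) = br_ob (src f) (src g);
  br_tgt : forall f g, tgt (br_ar f g) = br_ob (tgt f) (tgt g);
  br_idar : forall x y, br_ar (idar V x) (idar V y) = idar V (br_ob x y);
  br_comp : forall f f' g g', tgt f = src f' -> tgt g = src g' ->
    br_ar (f ;; f') (g ;; g') = br_ar f g ;; br_ar f' g'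
}.

End LinFunctor.

Section LeibnizTwoAlgebra.
Context (K : fieldType).

Section Jacobiator.
Context (V : two_vect K) (B : bilin_functor V)
  (J : tv_ob V -> tv_ob V -> tv_ob V -> tv_ar V).
Local Notation "⟦ x , y ⟧" := (br_ob B x y).
Local Notation "⟪ f , g ⟫" := (br_ar B f g).
Local Notation "1_ x" := (idar V x) (at level 8, x at level 2).

Definition jacobiator_natural : Prop := forall f g h,
  ⟪⟪f, g⟫, h⟫ ;; J (tgt f) (tgt g) (tgt h) =
  J (src f) (src g) (src h) ;; (⟪⟪f, h⟫, g⟫ + ⟪f, ⟪g, h⟫⟫).

Definition jacobiator_coherence : Prop := forall x y z w,
  ⟪J x y z, 1_w⟫ ;;
    (J ⟦x, z⟧ y w + J x ⟦y, z⟧ w) ;;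
    (⟪J x z w, 1_y⟫ + 1_⟦⟦x, z⟧, ⟦y, w⟧⟧ + 1_⟦⟦x, w⟧, ⟦y, z⟧⟧ + ⟪1_x, J y z w⟫)
  = J ⟦x, y⟧ z w ;;
    (⟪J x y w, 1_z⟫ + 1_⟦⟦x, y⟧, ⟦z, w⟧⟧) ;;
    (J ⟦x, w⟧ y z + J x ⟦y, w⟧ z + J x y ⟦z, w⟧).

End Jacobiator.

Record leib2 := Leib2 {
  leib2_vect :> two_vect K;
  brk : bilin_functor leib2_vect;
  jac : tv_ob leib2_vect -> tv_ob leib2_vect -> tv_ob leib2_vect ->
    tv_ar leib2_vect;
  jac_trilinear : trilinear jac;
  src_jac : forall x y z, src (jac x y z) = br_ob brk (br_ob brk x y) z;
  tgt_jac : forall x y z, tgt (jac x y z) =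
    br_ob brk (br_ob brk x z) y + br_ob brk x (br_ob brk y z);
  jac_natural : jacobiator_natural brk jac;
  jac_iso : forall x y z, is_iso_ar (jac x y z);
  jac_coherence : jacobiator_coherence brk jac
}.

End LeibnizTwoAlgebra.

Notation "⟦ x , y ⟧" := (br_ob (brk _) x y) : ring_scope.
Notation "⟪ f , g ⟫" := (br_ar (brk _) f g) : ring_scope.
Notation "1_ x" := (idar _ x) (at level 8, x at level 2) : ring_scope.

Section LeibnizTwoHom.
Context (K : fieldType).

Record leib2_hom (V W : leib2 K) := Leib2Hom {
  hfun :> lin_functor V W;
  hom2 : {bilinear tv_ob V -> tv_ob V -> tv_ar W};
  src_hom2 : forall x y, src (hom2 x y) = ⟦on_ob hfun x, on_ob hfun y⟧;
  tgt_hom2 : forall x y, tgt (hom2 x y) = on_ob hfun ⟦x, y⟧;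
  hom2_natural : forall f g,
    ⟪on_ar hfun f, on_ar hfun g⟫ ;; hom2 (tgt f) (tgt g) =
    hom2 (src f) (src g) ;; on_ar hfun ⟪f, g⟫;
  hom2_coherence : forall x y z,
    jac (on_ob hfun x) (on_ob hfun y) (on_ob hfun z) ;;
      (⟪hom2 x z, 1_(on_ob hfun y)⟫ + ⟪1_(on_ob hfun x), hom2 y z⟫) ;;
      (hom2 ⟦x, z⟧ y + hom2 x ⟦y, z⟧)
    = ⟪hom2 x y, 1_(on_ob hfun z)⟫ ;;
      hom2 ⟦x, y⟧ z ;;
      on_ar hfun (jac x y z)
}.

Record two_derivation (V : leib2 K) := TwoDerivation {
  dfun :> lin_functor V V;
  dtr : {bilinear tv_ob V -> tv_ob V -> tv_ar V};
  src_dtr : forall x y, src (dtr x y) = on_ob dfun ⟦x, y⟧;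
  tgt_dtr : forall x y, tgt (dtr x y) = ⟦on_ob dfun x, y⟧ + ⟦x, on_ob dfun y⟧;
  dtr_natural : forall f g,
    on_ar dfun ⟪f, g⟫ ;; dtr (tgt f) (tgt g) =
    dtr (src f) (src g) ;; (⟪on_ar dfun f, g⟫ + ⟪f, on_ar dfun g⟫);
  dtr_iso : forall x y, is_iso_ar (dtr x y);
  dtr_coherence : forall x y z,
    on_ar dfun (jac x y z) ;;
      (dtr ⟦x, z⟧ y + dtr x ⟦y, z⟧) ;;
      (⟪dtr x z, 1_y⟫ + 1_⟦⟦x, z⟧, on_ob dfun y⟧ + 1_⟦on_ob dfun x, ⟦y, z⟧⟧ +
       ⟪1_x, dtr y z⟫)
    = dtr ⟦x, y⟧ z ;;
      (⟪dtr x y, 1_z⟫ + 1_⟦⟦x, y⟧, on_ob dfun z⟧) ;;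
      (jac (on_ob dfun x) y z + jac x (on_ob dfun y) z + jac x y (on_ob dfun z))
}.

Record leibder2 := LeibDer2 {
  ld_alg :> leib2 K;
  ld_der : two_derivation ld_alg
}.

Local Notation D := (on_ob (ld_der _)).
Local Notation D1 := (on_ar (ld_der _)).

Record leibder2_hom (V W : leibder2) := LeibDer2Hom {
  ld_hom :> leib2_hom V W;
  phi : {linear tv_ob V -> tv_ar W};
  src_phi : forall x, src (phi x) = D (on_ob ld_hom x);
  tgt_phi : forall x, tgt (phi x) = on_ob ld_hom (D x);
  phi_natural : forall f,
    D1 (on_ar ld_hom f) ;; phi (tgt f) = phi (src f) ;; on_ar ld_hom (D1 f);
  phi_iso : forall x, is_iso_ar (phi x);
  phi_coherence : forall x y,
    D1 (hom2 ld_hom x y) ;;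
      phi ⟦x, y⟧ ;;
      on_ar ld_hom (dtr (ld_der V) x y)
    = dtr (ld_der W) (on_ob ld_hom x) (on_ob ld_hom y) ;;
      (⟪phi x, 1_(on_ob ld_hom y)⟫ + ⟪1_(on_ob ld_hom x), phi y⟫) ;;
      (hom2 ld_hom (D x) y + hom2 ld_hom x (D y))
}.

End LeibnizTwoHom.

Section LeibDer2Category.
Context (K : fieldType).

Lemma arr_on_ar (V W : two_vect K) (F : lin_functor V W) f :
  arr (on_ar F f) = on_ar F (arr f).
Proof. by rewrite !arr.unlock linearB on_src -on_idar. Qed.

Lemma arr_br1r (V : leib2 K) (f : tv_ar V) y :
  arr ⟪f, 1_y⟫ = ⟪arr f, 1_y⟫.
Proof. by rewrite !arr.unlock br_src linearBl src_idar -br_idar. Qed.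

Lemma arr_br1l (V : leib2 K) x (g : tv_ar V) :
  arr ⟪1_x, g⟫ = ⟪1_x, arr g⟫.
Proof. by rewrite !arr.unlock br_src linearBr src_idar -br_idar. Qed.

Lemma srcD (V : two_vect K) (f g : tv_ar V) : src (f + g) = src f + src g.
Proof. exact: linearD. Qed.

Lemma tgtD (V : two_vect K) (f g : tv_ar V) : tgt (f + g) = tgt f + tgt g.
Proof. exact: linearD. Qed.

Lemma on_obD (V W : two_vect K) (F : lin_functor V W) x y :
  on_ob F (x + y) = on_ob F x + on_ob F y.
Proof. exact: linearD. Qed.

Definition stE := (srcD, tgtD, on_obD, @src_idar, @tgt_idar, @br_src, @br_tgt, @on_src,
  @on_tgt, @src_jac, @tgt_jac, @src_hom2, @tgt_hom2, @src_dtr, @tgt_dtr,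
  @src_phi, @tgt_phi).

Ltac st := solve [repeat progress rewrite ?src_comp ?tgt_comp ?stE //=].
Ltac st_with sH tH :=
  solve [repeat progress rewrite ?src_comp ?tgt_comp ?stE ?sH ?tH //=].

Lemma arr_hom2_natural (V W : leib2 K) (F : leib2_hom V W) f g :
  arr ⟪on_ar F f, on_ar F g⟫ + arr (hom2 F (tgt f) (tgt g)) =
  arr (hom2 F (src f) (src g)) + on_ar F (arr ⟪f, g⟫).
Proof.
have := congr1 (@arr K W) (hom2_natural F f g).
rewrite !arr_comp; [|st ..].
by rewrite arr_on_ar.
Qed.

Lemma arr_hom2_coherence (V W : leib2 K) (F : leib2_hom V W) x y z :
  arr (jac (on_ob F x) (on_ob F y) (on_ob F z)) +
  (⟪arr (hom2 F x z), 1_(on_ob F y)⟫ + ⟪1_(on_ob F x), arr (hom2 F y z)⟫) +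
  (arr (hom2 F ⟦x, z⟧ y) + arr (hom2 F x ⟦y, z⟧)) =
  ⟪arr (hom2 F x y), 1_(on_ob F z)⟫ + arr (hom2 F ⟦x, y⟧ z) +
  on_ar F (arr (jac x y z)).
Proof.
have := congr1 (@arr K W) (hom2_coherence F x y z).
rewrite !arr_comp; [|st ..].
by rewrite !arrD arr_on_ar !arr_br1r !arr_br1l.
Qed.

Lemma arr_phi_natural (V W : leibder2 K) (F : leibder2_hom V W) f :
  on_ar (ld_der W) (on_ar F (arr f)) + arr (phi F (tgt f)) =
  arr (phi F (src f)) + on_ar F (on_ar (ld_der V) (arr f)).
Proof.
have := congr1 (@arr K W) (phi_natural F f).
rewrite !arr_comp; [|st ..].
by rewrite !arr_on_ar.
Qed.

Lemma arr_phi_coherence (V W : leibder2 K) (F : leibder2_hom V W) x y :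
  on_ar (ld_der W) (arr (hom2 F x y)) + arr (phi F ⟦x, y⟧) +
  on_ar F (arr (dtr (ld_der V) x y)) =
  arr (dtr (ld_der W) (on_ob F x) (on_ob F y)) +
  (⟪arr (phi F x), 1_(on_ob F y)⟫ + ⟪1_(on_ob F x), arr (phi F y)⟫) +
  (arr (hom2 F (on_ob (ld_der V) x) y) + arr (hom2 F x (on_ob (ld_der V) y))).
Proof.
have := congr1 (@arr K W) (phi_coherence F x y).
rewrite !arr_comp; [|st ..].
by rewrite !arrD !arr_on_ar !arr_br1r !arr_br1l.
Qed.


Lemma lin_functor_ext (V W : two_vect K) (F G : lin_functor V W) :
  on_ob F =1 on_ob G -> on_ar F =1 on_ar G -> F = G.
Proof.
case: F G => [a b p1 p2 p3 p4] [a' b' q1 q2 q3 q4] /=.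
move=> /linear_ext ea /linear_ext eb; subst a' b'.
by congr LinFunctor; apply: Prop_irrelevance.
Qed.

Lemma leib2_hom_ext (V W : leib2 K) (F G : leib2_hom V W) :
  on_ob F =1 on_ob G -> on_ar F =1 on_ar G -> hom2 F =2 hom2 G -> F = G.
Proof.
case: F G => [a b p1 p2 p3 p4] [a' b' q1 q2 q3 q4] /=.
move=> eo ea /bilinear_ext eb; have e := lin_functor_ext eo ea; subst a' b'.
by congr Leib2Hom; apply: Prop_irrelevance.
Qed.

Lemma leibder2_hom_ext (V W : leibder2 K) (F G : leibder2_hom V W) :
    on_ob F =1 on_ob G -> on_ar F =1 on_ar G -> hom2 F =2 hom2 G ->
  phi F =1 phi G -> F = G.
Proof.
case: F G => [a b p1 p2 p3 p4 p5] [a' b' q1 q2 q3 q4 q5] /=.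
move=> eo ea e2 /linear_ext eb; have e := leib2_hom_ext eo ea e2; subst a' b'.
by congr LeibDer2Hom; apply: Prop_irrelevance.
Qed.


Section Identity.
Context (V : leib2 K).

Fact hom2_id_linl (y : tv_ob V) : linear (fun x : tv_ob V => 1_⟦x, y⟧).
Proof. by move=> a u v; rewrite linearPl linearP. Qed.

Fact hom2_id_linr (x : tv_ob V) : linear (fun y : tv_ob V => 1_⟦x, y⟧).
Proof. by move=> a u v; rewrite !linearP. Qed.

Definition hom2_id := bilinear_pack hom2_id_linl hom2_id_linr.

Fact hom2_id_natural (f g : tv_ar V) :
  ⟪f, g⟫ ;; 1_⟦tgt f, tgt g⟧ = 1_⟦src f, src g⟧ ;; ⟪f, g⟫.
Proof. by rewrite -br_src -br_tgt seq_comp1l seq_comp1r. Qed.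

Fact hom2_id_coherence (x y z : tv_ob V) :
  jac x y z ;; (⟪1_⟦x, z⟧, 1_y⟫ + ⟪1_x, 1_⟦y, z⟧⟫) ;;
    (1_⟦⟦x, z⟧, y⟧ + 1_⟦x, ⟦y, z⟧⟧) =
  ⟪1_⟦x, y⟧, 1_z⟫ ;; 1_⟦⟦x, y⟧, z⟧ ;; jac x y z.
Proof.
apply: arr_inj; first by st.
rewrite !arr_comp; [|st ..].
by rewrite !arrD !br_idar !arr_idar; zmod.
Qed.

Definition leib2_hom_id : leib2_hom V V :=
  @Leib2Hom K V V (lin_functor_id V) hom2_id
    (fun x y => src_idar _) (fun x y => tgt_idar _)
    hom2_id_natural hom2_id_coherence.

End Identity.

Fact phi_id_natural (V : leibder2 K) (D := ld_der V) (f : tv_ar V) :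
  on_ar D f ;; 1_(on_ob D (tgt f)) = 1_(on_ob D (src f)) ;; on_ar D f.
Proof. by rewrite -on_src -on_tgt seq_comp1l seq_comp1r. Qed.

Fact phi_id_coherence (V : leibder2 K) (D := ld_der V) (x y : tv_ob V) :
  on_ar D 1_⟦x, y⟧ ;; 1_(on_ob D ⟦x, y⟧) ;; dtr D x y =
  dtr D x y ;; (⟪1_(on_ob D x), 1_y⟫ + ⟪1_x, 1_(on_ob D y)⟫) ;;
    (1_⟦on_ob D x, y⟧ + 1_⟦x, on_ob D y⟧).
Proof.
apply: arr_inj; first by st.
rewrite !arr_comp; [|st ..].
by rewrite on_idar !arrD !br_idar !arr_idar; zmod.
Qed.

Definition leibder2_hom_id (V : leibder2 K) : leibder2_hom V V :=
  @LeibDer2Hom K V V (leib2_hom_id V) (idar V \o on_ob (ld_der V))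
    (fun x => src_idar _) (fun x => tgt_idar _) (@phi_id_natural V)
    (fun x => is_iso_arT _) (@phi_id_coherence V).

Section Composition.
Context (U V W : leib2 K) (F : leib2_hom U V) (G : leib2_hom V W).

Definition hom2_comp_fun (x y : tv_ob U) : tv_ar W :=
  hom2 G (on_ob F x) (on_ob F y) ;; on_ar G (hom2 F x y).

Fact hom2_composable (x y : tv_ob U) :
  tgt (hom2 G (on_ob F x) (on_ob F y)) = src (on_ar G (hom2 F x y)).
Proof. by st. Qed.

Fact hom2_comp_linl y : linear (hom2_comp_fun^~ y).
Proof.
move=> a u v; rewrite -seq_compP_linear ?hom2_composable // /hom2_comp_fun.
by rewrite !(linearP, linearPl).
Qed.

Fact hom2_comp_linr x : linear (hom2_comp_fun x).
Proof.
move=> a u v; rewrite -seq_compP_linear ?hom2_composable // /hom2_comp_fun.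
by rewrite !linearP.
Qed.

Definition hom2_comp := bilinear_pack hom2_comp_linl hom2_comp_linr.

Fact src_hom2_comp x y : src (hom2_comp x y) =
  ⟦on_ob G (on_ob F x), on_ob G (on_ob F y)⟧.
Proof. by rewrite src_comp ?hom2_composable // src_hom2. Qed.

Fact tgt_hom2_comp x y : tgt (hom2_comp x y) = on_ob G (on_ob F ⟦x, y⟧).
Proof. by rewrite tgt_comp ?hom2_composable // on_tgt tgt_hom2. Qed.

Fact arr_hom2_comp x y : arr (hom2_comp x y) =
  arr (hom2 G (on_ob F x) (on_ob F y)) + on_ar G (arr (hom2 F x y)).
Proof. by rewrite arr_comp ?hom2_composable // arr_on_ar. Qed.

Fact hom2_comp_natural f g :
  ⟪on_ar G (on_ar F f), on_ar G (on_ar F g)⟫ ;; hom2_comp (tgt f) (tgt g) =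
  hom2_comp (src f) (src g) ;; on_ar G (on_ar F ⟪f, g⟫).
Proof.
move: src_hom2_comp tgt_hom2_comp arr_hom2_comp.
move: hom2_comp => H sH tH aH; apply: arr_inj; first by st_with sH tH.
rewrite !arr_comp; [|st_with sH tH ..].
rewrite !aH !arr_on_ar.
have := arr_hom2_natural G (on_ar F f) (on_ar F g); rewrite !on_tgt !on_src.
have /(congr1 (on_ar G)) := arr_hom2_natural F f g; rewrite !linearD /=.
move=> eF eG; rewrite addrA eG -!addrA; congr (_ + _).
by rewrite -eF -!arr_on_ar.
Qed.

Fact hom2_comp_coherence x y z :
  jac (on_ob G (on_ob F x)) (on_ob G (on_ob F y)) (on_ob G (on_ob F z)) ;;
    (⟪hom2_comp x z, 1_(on_ob G (on_ob F y))⟫ +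
     ⟪1_(on_ob G (on_ob F x)), hom2_comp y z⟫) ;;
    (hom2_comp ⟦x, z⟧ y + hom2_comp x ⟦y, z⟧) =
  ⟪hom2_comp x y, 1_(on_ob G (on_ob F z))⟫ ;; hom2_comp ⟦x, y⟧ z ;;
    on_ar G (on_ar F (jac x y z)).
Proof.
have := arr_hom2_coherence G (on_ob F x) (on_ob F y) (on_ob F z).
have /(congr1 (on_ar G)) := arr_hom2_coherence F x y z.
have nat1 a b (c : tv_ob U) := arr_hom2_natural G (hom2 F a b) 1_(on_ob F c).
have nat2 (c : tv_ob U) a b := arr_hom2_natural G 1_(on_ob F c) (hom2 F a b).
have {}nat1 a b c : ⟪on_ar G (arr (hom2 F a b)), 1_(on_ob G (on_ob F c))⟫ +
    arr (hom2 G (on_ob F ⟦a, b⟧) (on_ob F c)) =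
    arr (hom2 G ⟦on_ob F a, on_ob F b⟧ (on_ob F c)) +
    on_ar G ⟪arr (hom2 F a b), 1_(on_ob F c)⟫.
  have := nat1 a b c.
  by rewrite !stE on_idar !arr_br1r arr_on_ar.
have {}nat2 c a b : ⟪1_(on_ob G (on_ob F c)), on_ar G (arr (hom2 F a b))⟫ +
    arr (hom2 G (on_ob F c) (on_ob F ⟦a, b⟧)) =
    arr (hom2 G (on_ob F c) ⟦on_ob F a, on_ob F b⟧) +
    on_ar G ⟪1_(on_ob F c), arr (hom2 F a b)⟫.
  have := nat2 c a b.
  by rewrite !stE on_idar !arr_br1l arr_on_ar.
have n1 := nat1 x z y; have n2 := nat2 x y z; have n3 := nat1 x y z.
move: {nat1 nat2} src_hom2_comp tgt_hom2_comp arr_hom2_comp.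
move: hom2_comp => H sH tH aH eF eG; apply: arr_inj; first by st_with sH tH.
rewrite !arr_comp; [|st_with sH tH ..].
rewrite !arrD !arr_on_ar !arr_br1r !arr_br1l !aH.
rewrite !(linearD, linearDl, linearDr) /= in eF eG n1 n2 n3 *.
apply: (zmod_comb eF); apply: (zmod_comb eG); apply: (zmod_comb n1).
by apply: (zmod_comb n2); apply: (zmod_comb (esym n3)); zmod.
Qed.

Definition leib2_hom_comp : leib2_hom U W :=
  @Leib2Hom K U W (lin_functor_comp F G) hom2_comp src_hom2_comp tgt_hom2_comp
    hom2_comp_natural hom2_comp_coherence.

End Composition.

Section PairComposition.
Context (U V W : leibder2 K) (F : leibder2_hom U V) (G : leibder2_hom V W).
Local Notation DU := (ld_der U).
Local Notation DW := (ld_der W).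

Definition phi_comp_fun (x : tv_ob U) : tv_ar W :=
  phi G (on_ob F x) ;; on_ar G (phi F x).

Fact phi_composable x : tgt (phi G (on_ob F x)) = src (on_ar G (phi F x)).
Proof. by st. Qed.

Fact phi_comp_linear : linear phi_comp_fun.
Proof.
move=> a u v; rewrite -seq_compP_linear ?phi_composable // /phi_comp_fun.
by rewrite !linearP.
Qed.

Definition phi_comp := linear_pack phi_comp_linear.

Fact src_phi_comp x : src (phi_comp x) = on_ob DW (on_ob G (on_ob F x)).
Proof. by rewrite src_comp ?phi_composable // src_phi. Qed.

Fact tgt_phi_comp x : tgt (phi_comp x) = on_ob G (on_ob F (on_ob DU x)).
Proof. by rewrite tgt_comp ?phi_composable // on_tgt tgt_phi. Qed.

Fact arr_phi_comp x :
  arr (phi_comp x) = arr (phi G (on_ob F x)) + on_ar G (arr (phi F x)).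
Proof. by rewrite arr_comp ?phi_composable // arr_on_ar. Qed.

Fact phi_comp_natural f :
  on_ar DW (on_ar G (on_ar F f)) ;; phi_comp (tgt f) =
  phi_comp (src f) ;; on_ar G (on_ar F (on_ar DU f)).
Proof.
move: src_phi_comp tgt_phi_comp arr_phi_comp.
move: phi_comp => P sP tP aP.
have := arr_phi_natural G (on_ar F f); rewrite !on_tgt !on_src arr_on_ar.
have /(congr1 (on_ar G)) := arr_phi_natural F f; rewrite !linearD /= => eF eG.
apply: arr_inj; first by st_with sP tP.
rewrite !arr_comp; [|st_with sP tP ..].
rewrite !aP !arr_on_ar.
by apply: (zmod_comb eF); apply: (zmod_comb eG); zmod.
Qed.

Fact phi_comp_coherence x y :
  on_ar DW (hom2_comp F G x y) ;; phi_comp ⟦x, y⟧ ;;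
    on_ar G (on_ar F (dtr DU x y)) =
  dtr DW (on_ob G (on_ob F x)) (on_ob G (on_ob F y)) ;;
    (⟪phi_comp x, 1_(on_ob G (on_ob F y))⟫ +
     ⟪1_(on_ob G (on_ob F x)), phi_comp y⟫) ;;
    (hom2_comp F G (on_ob DU x) y + hom2_comp F G x (on_ob DU y)).
Proof.
move: src_phi_comp tgt_phi_comp arr_phi_comp.
move: phi_comp => P sP tP aP.
move: (src_hom2_comp F G) (tgt_hom2_comp F G) (arr_hom2_comp F G).
move: (hom2_comp F G) => M sM tM aM.
have eG := arr_phi_coherence G (on_ob F x) (on_ob F y).
have eF := congr1 (on_ar G) (arr_phi_coherence F x y).
have n1 := arr_phi_natural G (hom2 F x y).
have n2 := arr_hom2_natural G 1_(on_ob F x) (phi F y).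
have n3 := arr_hom2_natural G (phi F x) 1_(on_ob F y).
rewrite !stE in n1; rewrite !stE !on_idar in n2 n3.
rewrite !arr_br1l !arr_on_ar in n2; rewrite !arr_br1r !arr_on_ar in n3.
apply: arr_inj; first by st_with (sP, sM) (tP, tM).
rewrite !arr_comp; [|st_with (sP, sM) (tP, tM) ..].
rewrite !arrD !arr_on_ar !arr_br1r !arr_br1l !aM !aP.
rewrite !(linearD, linearDl, linearDr) /= in eF eG n1 n2 n3 *.
apply: (zmod_comb eF); apply: (zmod_comb eG); apply: (zmod_comb n1).
by apply: (zmod_comb (esym n2)); apply: (zmod_comb (esym n3)); zmod.
Qed.

Definition leibder2_hom_comp : leibder2_hom U W :=
  @LeibDer2Hom K U W (leib2_hom_comp F G) phi_comp src_phi_comp tgt_phi_comp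
    phi_comp_natural (fun x => is_iso_arT _) phi_comp_coherence.

End PairComposition.

Fact leibder2_comp1l (V W : leibder2 K) (F : leibder2_hom V W) :
  leibder2_hom_comp (leibder2_hom_id V) F = F.
Proof.
apply: leibder2_hom_ext => //= [x y|x]; rewrite /hom2_comp_fun /phi_comp_fun /=.
  by rewrite on_idar -tgt_hom2 seq_comp1r.
by rewrite on_idar -tgt_phi seq_comp1r.
Qed.

Fact leibder2_comp1r (V W : leibder2 K) (F : leibder2_hom V W) :
  leibder2_hom_comp F (leibder2_hom_id W) = F.
Proof.
apply: leibder2_hom_ext => //= [x y|x]; rewrite /hom2_comp_fun /phi_comp_fun /=.
  by rewrite -src_hom2 seq_comp1l.
by rewrite -src_phi seq_comp1l.
Qed.

Fact leibder2_compA (T U V W : leibder2 K) (F : leibder2_hom T U)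
    (G : leibder2_hom U V) (H : leibder2_hom V W) :
  leibder2_hom_comp F (leibder2_hom_comp G H) =
  leibder2_hom_comp (leibder2_hom_comp F G) H.
Proof.
apply: leibder2_hom_ext => //= [x y|x]; rewrite /hom2_comp_fun /phi_comp_fun /=.
  rewrite /hom2_comp_fun on_comp ?hom2_composable // seq_compA //; st.
rewrite /phi_comp_fun on_comp ?phi_composable // seq_compA //; st.
Qed.

Definition LeibDer2_cat : category :=
  @Category (leibder2 K) (@leibder2_hom K) leibder2_hom_id leibder2_hom_comp
    leibder2_comp1l leibder2_comp1r leibder2_compA.

End LeibDer2Category.

Section ShLeib.
Context (K : fieldType).

(* 2-term sh Leibniz algebras; l00, l01, l10 are the components A_0 x A_0 -> A_0,
   A_0 x A_1 -> A_1 and A_1 x A_0 -> A_1 of l_2 *)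
Record sh_leib := ShLeib {
  sh1 : lmodType K;
  sh0 : lmodType K;
  dif : {linear sh1 -> sh0};
  l00 : {bilinear sh0 -> sh0 -> sh0};
  l01 : {bilinear sh0 -> sh1 -> sh1};
  l10 : {bilinear sh1 -> sh0 -> sh1};
  l3 : sh0 -> sh0 -> sh0 -> sh1;
  l3_trilinear : trilinear l3;
  dif_l01 : forall x m, dif (l01 x m) = l00 x (dif m);
  dif_l10 : forall m x, dif (l10 m x) = l00 (dif m) x;
  l01_dif : forall m n, l01 (dif m) n = l10 m (dif n);
  dif_l3 : forall x y z,
    - dif (l3 x y z) = l00 (l00 x y) z - l00 (l00 x z) y - l00 x (l00 y z);
  l3_dif3 : forall x y m,
    - l3 x y (dif m) = l01 (l00 x y) m - l10 (l01 x m) y - l01 x (l01 y m);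
  l3_dif2 : forall x m y,
    - l3 x (dif m) y = l10 (l01 x m) y - l01 (l00 x y) m - l01 x (l10 m y);
  l3_dif1 : forall m x y,
    - l3 (dif m) x y = l10 (l10 m x) y - l10 (l10 m y) x - l10 m (l00 x y);
  l3_coherence : forall x y z w,
    l01 x (l3 y z w) + l10 (l3 x z w) y - l10 (l3 x y w) z + l10 (l3 x y z) w =
    l3 (l00 x y) z w - l3 (l00 x z) y w + l3 (l00 x w) y z
    - l3 x (l00 y z) w + l3 x (l00 y w) z + l3 x y (l00 z w)
}.

Record sh_hom (A A' : sh_leib) := ShHom {
  sf0 : {linear sh0 A -> sh0 A'};
  sf1 : {linear sh1 A -> sh1 A'};
  sf2 : {bilinear sh0 A -> sh0 A -> sh1 A'};
  sf_dif : forall m, dif A' (sf1 m) = sf0 (dif A m);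
  dif_sf2 : forall x y,
    dif A' (sf2 x y) = sf0 (l00 A x y) - l00 A' (sf0 x) (sf0 y);
  sf2_difr : forall x m,
    sf2 x (dif A m) = sf1 (l01 A x m) - l01 A' (sf0 x) (sf1 m);
  sf2_difl : forall m x,
    sf2 (dif A m) x = sf1 (l10 A m x) - l10 A' (sf1 m) (sf0 x);
  sf2_coherence : forall x y z,
    sf1 (l3 x y z) + l10 A' (sf2 x y) (sf0 z) - l10 A' (sf2 x z) (sf0 y)
    - l01 A' (sf0 x) (sf2 y z) + sf2 (l00 A x y) z - sf2 (l00 A x z) y
    - sf2 x (l00 A y z) - l3 (sf0 x) (sf0 y) (sf0 z) = 0
}.

Record homotopy_derivation (A : sh_leib) := HomotopyDerivation {
  th0 : {linear sh0 A -> sh0 A};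
  th1 : {linear sh1 A -> sh1 A};
  th2 : {bilinear sh0 A -> sh0 A -> sh1 A};
  th_dif : forall m, dif A (th1 m) = th0 (dif A m);
  dif_th2 : forall x y,
    dif A (th2 x y) = th0 (l00 A x y) - l00 A (th0 x) y - l00 A x (th0 y);
  th2_difr : forall x m,
    th2 x (dif A m) = th1 (l01 A x m) - l01 A (th0 x) m - l01 A x (th1 m);
  th2_difl : forall m x,
    th2 (dif A m) x = th1 (l10 A m x) - l10 A (th1 m) x - l10 A m (th0 x);
  th2_coherence : forall x y z,
    l3 (th0 x) y z + l3 x (th0 y) z + l3 x y (th0 z) - th1 (l3 x y z) =
    l10 A (th2 x y) z - l10 A (th2 x z) y - l01 A x (th2 y z)
    + th2 (l00 A x y) z - th2 (l00 A x z) y - th2 x (l00 A y z)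
}.

Record sh_leibder := ShLeibDer {
  sd_alg :> sh_leib;
  sd_der : homotopy_derivation sd_alg
}.

Record sh_leibder_hom (A A' : sh_leibder) := ShLeibDerHom {
  sd_hom :> sh_hom A A';
  sB : {linear sh0 A -> sh1 A'};
  dif_sB : forall x, sf0 sd_hom (th0 (sd_der A) x) - th0 (sd_der A') (sf0 sd_hom x)
    = dif A' (sB x);
  sB_dif : forall m, sf1 sd_hom (th1 (sd_der A) m) - th1 (sd_der A') (sf1 sd_hom m)
    = sB (dif A m);
  sB_coherence : forall x y,
    sf1 sd_hom (th2 (sd_der A) x y)
    - th2 (sd_der A') (sf0 sd_hom x) (sf0 sd_hom y) =
    th1 (sd_der A') (sf2 sd_hom x y)
    - sf2 sd_hom (th0 (sd_der A) x) y - sf2 sd_hom x (th0 (sd_der A) y)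
    + sB (l00 A x y) - l10 A' (sB x) (sf0 sd_hom y) - l01 A' (sf0 sd_hom x) (sB y)
}.

Lemma sh_hom_ext (A B : sh_leib) (f g : sh_hom A B) :
  sf0 f =1 sf0 g -> sf1 f =1 sf1 g -> sf2 f =2 sf2 g -> f = g.
Proof.
case: f g => [a b c p1 p2 p3 p4 p5] [a' b' c' q1 q2 q3 q4 q5] /=.
move=> /linear_ext ea /linear_ext eb /bilinear_ext ec; subst a' b' c'.
by congr ShHom; apply: Prop_irrelevance.
Qed.

Lemma sh_leibder_hom_ext (A B : sh_leibder) (f g : sh_leibder_hom A B) :
    sf0 f =1 sf0 g -> sf1 f =1 sf1 g -> sf2 f =2 sf2 g -> sB f =1 sB g ->
  f = g.
Proof.
case: f g => [a b p1 p2 p3] [a' b' q1 q2 q3] /=.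
move=> e0 e1 e2 /linear_ext eb; have ea := sh_hom_ext e0 e1 e2; subst a' b'.
by congr ShLeibDerHom; apply: Prop_irrelevance.
Qed.

Section Identity.
Context (A : sh_leib).

Fact zero_linear (U V : lmodType K) : linear (fun _ : U => 0 : V).
Proof. by move=> a u v; rewrite scaler0 addr0. Qed.

Definition linear_zero (U V : lmodType K) : {linear U -> V} :=
  linear_pack (@zero_linear U V).

Definition bilinear_zero (U V W : lmodType K) : {bilinear U -> V -> W} :=
  bilinear_pack (f := fun _ _ => 0) (fun _ => @zero_linear U W)
    (fun _ => @zero_linear V W).

Definition sh_hom_id : sh_hom A A.
Proof.
exists idfun idfun (bilinear_zero _ _ _) => //= [x y|x m|m x|x y z];
  by rewrite ?linear0 ?linear0l ?linear0r; zmod.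
Defined.

End Identity.

Definition sh_leibder_hom_id (A : sh_leibder) : sh_leibder_hom A A.
Proof.
exists (sh_hom_id A) (linear_zero _ _) => /= [x|m|x y];
  by rewrite ?linear0 ?linear0l ?linear0r; zmod.
Defined.

Section Composition.
Context (A B C : sh_leib) (f : sh_hom A B) (g : sh_hom B C).

Definition sf2_comp_fun (x y : sh0 A) : sh1 C :=
  sf2 g (sf0 f x) (sf0 f y) + sf1 g (sf2 f x y).

Fact sf2_comp_linl y : linear (sf2_comp_fun^~ y).
Proof.
by move=> a u v; rewrite /sf2_comp_fun !(linearP, linearPl) /= scalerDr; zmod.
Qed.

Fact sf2_comp_linr x : linear (sf2_comp_fun x).
Proof. by move=> a u v; rewrite /sf2_comp_fun !linearP /= scalerDr; zmod. Qed.

Definition sf2_comp := bilinear_pack sf2_comp_linl sf2_comp_linr.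

Definition sh_hom_comp : sh_hom A C.
Proof.
exists (sf0 g \o sf0 f) (sf1 g \o sf1 f) sf2_comp => /=;
  rewrite /sf2_comp_fun.
- by move=> m; rewrite !sf_dif.
- by move=> x y; rewrite linearD dif_sf2 sf_dif dif_sf2 linearB /=; zmod.
- by move=> x m; rewrite -sf_dif !sf2_difr linearB /=; zmod.
- by move=> m x; rewrite -sf_dif !sf2_difl linearB /=; zmod.
- move=> x y z.
  have eG := sf2_coherence g (sf0 f x) (sf0 f y) (sf0 f z).
  have eF := congr1 (sf1 g) (sf2_coherence f x y z).
  have n1 := sf2_difl g (sf2 f x y) (sf0 f z).
  have n2 := sf2_difl g (sf2 f x z) (sf0 f y).
  have n3 := sf2_difr g (sf0 f x) (sf2 f y z).
  rewrite !(dif_sf2, linearB, linearBl, linearD, linearDl, linear0) /=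
    in eG eF n1 n2 n3 *.
  apply: (zmod_comb eG); apply: (zmod_comb eF); apply: (zmod_comb n1).
  by apply: (zmod_comb (esym n2)); apply: (zmod_comb (esym n3)); zmod.
Defined.

End Composition.

Section PairComposition.
Context (A B C : sh_leibder) (f : sh_leibder_hom A B) (g : sh_leibder_hom B C).

Definition sh_leibder_hom_comp : sh_leibder_hom A C.
Proof.
exists (sh_hom_comp f g) ((sB g \o sf0 f) \+ (sf1 g \o sB f)) => /=.
- by move=> x; rewrite linearD sf_dif -!dif_sB linearB /=; zmod.
- by move=> m; rewrite -sf_dif -!sB_dif linearB /=; zmod.
- move=> x y; rewrite /sf2_comp_fun.
  have eG := sB_coherence g (sf0 f x) (sf0 f y).
  have eF := congr1 (sf1 g) (sB_coherence f x y).
  have n1 := sB_dif g (sf2 f x y).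
  have n2 := sf2_difl g (sB f x) (sf0 f y).
  have n3 := sf2_difr g (sf0 f x) (sB f y).
  rewrite ?dif_sf2 -?dif_sB in n1 n2 n3.
  rewrite !(linearB, linearBl, linearD, linearDl) /= in eG eF n1 n2 n3 *.
  apply: (zmod_comb eG); apply: (zmod_comb eF); apply: (zmod_comb n1).
  by apply: (zmod_comb n2); apply: (zmod_comb n3); zmod.
Defined.

End PairComposition.

Fact sh_leibder_comp1l (A B : sh_leibder) (f : sh_leibder_hom A B) :
  sh_leibder_hom_comp (sh_leibder_hom_id A) f = f.
Proof.
by apply: sh_leibder_hom_ext => //= [x y|x];
  rewrite /sf2_comp_fun /= ?linear0 addr0.
Qed.

Fact sh_leibder_comp1r (A B : sh_leibder) (f : sh_leibder_hom A B) :
  sh_leibder_hom_comp f (sh_leibder_hom_id B) = f.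
Proof.
by apply: sh_leibder_hom_ext => //= [x y|x]; rewrite /sf2_comp_fun /= add0r.
Qed.

Fact sh_leibder_compA (A B C D : sh_leibder) (f : sh_leibder_hom A B)
    (g : sh_leibder_hom B C) (h : sh_leibder_hom C D) :
  sh_leibder_hom_comp f (sh_leibder_hom_comp g h) =
  sh_leibder_hom_comp (sh_leibder_hom_comp f g) h.
Proof.
by apply: sh_leibder_hom_ext => //= [x y|x];
  rewrite /sf2_comp_fun /= linearD addrA.
Qed.

Definition TwoLeibDerInfty_cat : category :=
  @Category sh_leibder sh_leibder_hom sh_leibder_hom_id sh_leibder_hom_comp
    sh_leibder_comp1l sh_leibder_comp1r sh_leibder_compA.

End ShLeib.

(* Main.v *)
Require Import Defs.
From HB Require Import structures.
From mathcomp Require Import all_boot all_order all_algebra.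
(* The vector space library also has a [Hom]; this makes it mean the hom-types
   of a category again. *)
Import Defs.

Set Implicit Arguments.
Unset Strict Implicit.
Unset Printing Implicit Defensive.

Import GRing.Theory.
Local Open Scope ring_scope.

(** The equivalence is the Dold-Kan correspondence for 2-vector spaces, carrying
    the brackets and derivations along.  A 2-vector space is the same thing as a
    2-term complex: an arrow [f] splits uniquely as the identity of its source
    plus a kernel component [arr f] in the kernel of [src], and composition of
    arrows adds kernel components.  So a Leibniz 2-algebra with a 2-derivation
    gives a 2-term sh Leibniz algebra with a homotopy derivation on the complex
    [tgt : ker src -> objects]: the maps [l01] and [l10] are brackets with
    identity arrows, while [l3], the map [f_2] of a morphism and its homotopy
    [B] are the kernel components of the Jacobiator, of [F_2] and of [Phi].
    Only the derivation changes sign: by the formula for its differential,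
    [theta_2 x y] is an arrow from [[theta x, y] + [x, theta y]] to
    [theta [x, y]], whereas the transformation of a 2-derivation runs the other
    way, so [theta_2] is minus its kernel component.

    Under this dictionary each pasting diagram becomes a sum of kernel
    components, and the coherence conditions match the sh identities term by
    term.  Naturality is the only condition quantified over all arrows; by
    [arr_brk], functoriality of the bracket expresses the kernel component of a
    bracket by brackets of kernel elements with identities.  Hence naturality is
    equivalent to its instances where one argument is in the kernel and the
    others are identities, and these are the sh identities involving the
    differential.

    The resulting functor [normalization] is fully faithful: a morphism between
    normalized pairs is lifted by prescribing sources and kernel components
    ([lift_leibder_hom]), and arrows are determined by these ([ar_ext]).  It is
    essentially surjective: from a complex [d : A_1 -> A_0] the 2-vector space
    with arrows [A_0 * A_1], where [(x, m)] goes from [x] to [x + d m], inherits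
    all the structure ([complex_leibder]), and its normalization is strictly
    isomorphic to the original pair ([counit]). *)

(** * Equivalences from fully faithful, essentially surjective functors *)

Section EquivalenceCriterion.
Context (C D : category) (F : functor C D).
Context (lift : forall a b : C, Hom (F a) (F b) -> Hom a b).
Hypothesis liftK : forall a b (h : Hom (F a) (F b)), fhom F (lift h) = h.
Hypothesis fhomK : forall a b (f : Hom a b), lift (fhom F f) = f.
Context (G : D -> C) (eps : forall d, Hom (F (G d)) d).
Context (epsV : forall d, Hom d (F (G d))).
Hypothesis epsVK : forall d, compm (epsV d) (eps d) = idm d.
Hypothesis epsK : forall d, compm (eps d) (epsV d) = idm (F (G d)).

Lemma fhom_inj a b : injective (@fhom C D F a b).
Proof. exact: can_inj (@fhomK a b). Qed.

Definition quasi_inverse : functor D C.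
Proof.
exists G (fun d d' f => lift (compm (compm (eps d) f) (epsV d'))).
- by move=> d; apply: fhom_inj; rewrite liftK fhom1 compm1r epsK.
- move=> d d' d'' f g; apply: fhom_inj; rewrite fhomM !liftK.
  by rewrite -!compmA; do 3?congr compm; rewrite !compmA epsVK compm1l.
Defined.

(** Full faithfulness is given by the inverse [lift] of [fhom F], and essential
    surjectivity by chosen preimages [G d] with isomorphisms [eps d], so that
    the quasi-inverse is obtained by conjugation with [eps] and no choice
    principle enters. *)
Lemma equivalent_categories_ff_es : equivalent_categories C D.
Proof.
exists F, quasi_inverse; split.
  exists (fun c => lift (epsV (F c))); split=> [a b f|c] /=.
    apply: fhom_inj; rewrite !fhomM !liftK.
    by rewrite !compmA epsVK compm1l.
  exists (lift (eps (F c))); split; apply: fhom_inj;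
    by rewrite fhomM !liftK ?epsVK ?epsK fhom1.
exists eps; split=> [d d' f|d] /=; last by exists (epsV d).
by rewrite liftK -!compmA epsVK compm1r.
Qed.

End EquivalenceCriterion.

(** * The kernel of the source map *)

Section SourceKernel.
Context (K : fieldType) (V : two_vect K).

Definition src_zero : {pred tv_ar V} := [pred f | src f == 0].

Fact src_zero_submod_closed : submod_closed src_zero.
Proof.
split=> [|a f g]; rewrite !inE ?linear0 // => /eqP f0 /eqP g0.
by rewrite linearP f0 g0 scaler0 addr0.
Qed.
HB.instance Definition _ :=
  GRing.isSubmodClosed.Build K (tv_ar V) src_zero src_zero_submod_closed.

Record src_ker := SrcKer { ker_ar : tv_ar V; _ : ker_ar \in src_zero }.
HB.instance Definition _ := [isSub for ker_ar].
HB.instance Definition _ := [Choice of src_ker by <:].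
HB.instance Definition _ := [SubChoice_isSubLmodule of src_ker by <:].

Lemma src_ker_ar (m : src_ker) : src (ker_ar m) = 0.
Proof. by case: m => f /= /eqP. Qed.

Lemma ker_ar_inj : injective ker_ar.
Proof. exact: val_inj. Qed.

Fact ker_ar_linear : linear ker_ar.
Proof. by move=> a u v; rewrite -[LHS]/(val _) linearP. Qed.
HB.instance Definition _ :=
  GRing.isLinear.Build K src_ker (tv_ar V) *:%R ker_ar ker_ar_linear.

Lemma ker_arD m n : ker_ar (m + n) = ker_ar m + ker_ar n.
Proof. exact: linearD. Qed.

Lemma ker_arB m n : ker_ar (m - n) = ker_ar m - ker_ar n.
Proof. exact: linearB. Qed.

Lemma ker_arN m : ker_ar (- m) = - ker_ar m.
Proof. exact: linearN. Qed.

Fact arr_src_zero (f : tv_ar V) : arr f \in src_zero.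
Proof. by rewrite inE arr.unlock linearB src_idar subrr. Qed.

(** The projection of [arr] onto its image, so that kernel components live in a
    vector space of their own: it is the degree 1 part of the complex. *)
Definition ker_arr (f : tv_ar V) : src_ker := SrcKer (arr_src_zero f).

Lemma ker_arrK f : ker_ar (ker_arr f) = arr f. Proof. by []. Qed.

Fact ker_arr_linear : linear ker_arr.
Proof.
move=> a f g; apply: ker_ar_inj; rewrite linearP !ker_arrK /= !arr.unlock.
by rewrite !linearP scalerDr addrACA.
Qed.
HB.instance Definition _ :=
  GRing.isLinear.Build K (tv_ar V) src_ker *:%R ker_arr ker_arr_linear.

Lemma arr_ker_ar m : arr (ker_ar m) = ker_ar m.
Proof. by rewrite arr.unlock src_ker_ar linear0 subr0. Qed.

Lemma arr_idem (f : tv_ar V) : arr (arr f) = arr f.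
Proof. exact: (arr_ker_ar (ker_arr f)). Qed.

Lemma ker_ar_arrK : cancel ker_ar ker_arr.
Proof. by move=> m; apply: ker_ar_inj; rewrite ker_arrK arr_ker_ar. Qed.

Lemma idar_arr (f : tv_ar V) : idar V (src f) + arr f = f.
Proof. by rewrite arr.unlock addrC subrK. Qed.

Lemma tgt_arr (f : tv_ar V) : tgt (arr f) = tgt f - src f.
Proof. by rewrite arr.unlock linearB tgt_idar. Qed.

End SourceKernel.

Section BracketKernel.
Context (K : fieldType) (V : leib2 K).
Implicit Types m n : src_ker V.

Fact brk_kerr x m : arr ⟪1_x, ker_ar m⟫ = ⟪1_x, ker_ar m⟫.
Proof. by rewrite arr_br1l arr_ker_ar. Qed.

Fact brk_kerl m x : arr ⟪ker_ar m, 1_x⟫ = ⟪ker_ar m, 1_x⟫.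
Proof. by rewrite arr_br1r arr_ker_ar. Qed.

(** By functoriality, the bracket of two kernel elements may be computed by
    padding them with identities on either side: writing them as [m ;; 1] and
    [0 ;; n], or as [0 ;; m] and [n ;; 1], one of the two factors of the
    resulting composite is a bracket with 0.  This is the Peiffer-type identity
    behind [l_2 (d m) n = l_2 m (d n)]. *)
Lemma brk_ker m n :
  ⟪ker_ar m, ker_ar n⟫ = ⟪1_(tgt (ker_ar m)), ker_ar n⟫ /\
  ⟪ker_ar m, ker_ar n⟫ = ⟪ker_ar m, 1_(tgt (ker_ar n))⟫.
Proof.
have id0 (W : two_vect K) : idar W 0 = 0 by exact: linear0.
have l1 k : 0 ;; ker_ar k = ker_ar k :> tv_ar V.
  by have := seq_comp1l V (ker_ar k); rewrite src_ker_ar id0.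
split.
- rewrite -[in LHS](seq_comp1r V (ker_ar m)) -[in LHS](l1 n).
  rewrite br_comp ?src_idar ?linear0 ?src_ker_ar //.
  by have := seq_comp1l V ⟪1_(tgt (ker_ar m)), ker_ar n⟫;
    rewrite br_src src_ker_ar linear0r id0.
- rewrite -[in LHS](seq_comp1r V (ker_ar n)) -[in LHS](l1 m).
  rewrite br_comp ?src_idar ?linear0 ?src_ker_ar // linear0l.
  by have := seq_comp1l V ⟪ker_ar m, 1_(tgt (ker_ar n))⟫;
    rewrite br_src src_ker_ar linear0l id0.
Qed.

(** The asymmetry between target and source comes from using only one of the two
    expressions of the bracket of kernel elements: expanding both arguments, the
    term [⟪arr f, arr g⟫] is absorbed into [⟪1_(src f), arr g⟫] and moves its
    first argument to [tgt f = src f + tgt (arr f)]. *)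
Lemma arr_brk (f g : tv_ar V) :
  arr ⟪f, g⟫ = ⟪1_(tgt f), arr g⟫ + ⟪arr f, 1_(src g)⟫.
Proof.
rewrite -{1}(idar_arr f) -{1}(idar_arr g) !linearDl !linearDr /= !arrD.
rewrite br_idar arr_idar arr_br1l arr_br1r -(ker_arrK f) -(ker_arrK g).
rewrite !arr_ker_ar (brk_ker _ _).1 arr_br1l arr_ker_ar /= tgt_arr.
rewrite linearB linearBl /=; zmod.
Qed.

End BracketKernel.

(** Proves equalities between sources and targets of composites of arrows of [V],
    with [E] the endpoints of the arrows involved.  The side conditions of
    [src_comp] and [tgt_comp] have the same shape.  Instantiating the rules at
    [V] avoids costly unification of structures. *)
Ltac endpoints V E :=
  lazymatch goal with
  | |- context [seq_comp _ _ _] =>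
    first [rewrite (@tgt_comp _ V) | rewrite (@src_comp _ V)]; endpoints V E
  | _ =>
    repeat progress rewrite ?(@srcD _ V) ?(@tgtD _ V) ?(@br_src _ V)
      ?(@br_tgt _ V) ?(@src_idar _ V) ?(@tgt_idar _ V) ?E;
    first [ done | solve [rewrite /=; zmod]
          | solve [rewrite ?(linearDl, linearDr) /=; zmod] ]
  end.

(** * Kernel components of the structure of a pair *)

Section ArrEquations.
Context (K : fieldType) (V : leib2 K).

Lemma arr_jac_natural (f g h : tv_ar V) :
  arr ⟪⟪f, g⟫, h⟫ + arr (jac (tgt f) (tgt g) (tgt h)) =
  arr (jac (src f) (src g) (src h)) + (arr ⟪⟪f, h⟫, g⟫ + arr ⟪f, ⟪g, h⟫⟫).
Proof.
have := congr1 (@arr K V) (jac_natural f g h).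
by rewrite !arr_comp; [rewrite arrD|endpoints V (@src_jac K V, @tgt_jac K V) ..].
Qed.

Lemma arr_jac_coherence (x y z w : tv_ob V) :
  ⟪arr (jac x y z), 1_w⟫ + (arr (jac ⟦x, z⟧ y w) + arr (jac x ⟦y, z⟧ w)) +
  (⟪arr (jac x z w), 1_y⟫ + ⟪1_x, arr (jac y z w)⟫) =
  arr (jac ⟦x, y⟧ z w) + ⟪arr (jac x y w), 1_z⟫ +
  (arr (jac ⟦x, w⟧ y z) + arr (jac x ⟦y, w⟧ z) + arr (jac x y ⟦z, w⟧)).
Proof.
have := congr1 (@arr K V) (jac_coherence x y z w).
rewrite !arr_comp; [|endpoints V (@src_jac K V, @tgt_jac K V) ..].
by rewrite !arrD !arr_br1r !arr_br1l !arr_idar !addr0.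
Qed.

End ArrEquations.

Section ArrDerivation.
Context (K : fieldType) (V : leib2 K) (D : two_derivation V).

Lemma arr_dtr_natural (f g : tv_ar V) :
  on_ar D (arr ⟪f, g⟫) + arr (dtr D (tgt f) (tgt g)) =
  arr (dtr D (src f) (src g)) + (arr ⟪on_ar D f, g⟫ + arr ⟪f, on_ar D g⟫).
Proof.
have := congr1 (@arr K V) (dtr_natural D f g).
rewrite !arr_comp; [|endpoints V (@src_dtr K V D, @tgt_dtr K V D,
  @on_src K V V D, @on_tgt K V V D) ..].
by rewrite !arrD arr_on_ar.
Qed.

Lemma arr_dtr_coherence (x y z : tv_ob V) :
  on_ar D (arr (jac x y z)) + (arr (dtr D ⟦x, z⟧ y) + arr (dtr D x ⟦y, z⟧)) +
  (⟪arr (dtr D x z), 1_y⟫ + ⟪1_x, arr (dtr D y z)⟫) =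
  arr (dtr D ⟦x, y⟧ z) + ⟪arr (dtr D x y), 1_z⟫ +
  (arr (jac (on_ob D x) y z) + arr (jac x (on_ob D y) z) +
   arr (jac x y (on_ob D z))).
Proof.
have := congr1 (@arr K V) (dtr_coherence D x y z).
rewrite !arr_comp; [|endpoints V (@src_jac K V, @tgt_jac K V, @src_dtr K V D,
  @tgt_dtr K V D, @on_src K V V D, @on_tgt K V V D, @on_obD K V V D) ..].
by rewrite !arrD arr_on_ar !arr_br1r !arr_br1l !arr_idar !addr0.
Qed.

End ArrDerivation.

(** * The normalization functor *)

Section NormalizedComplex.
Context (K : fieldType) (V : leib2 K).
Implicit Types (x y z w : tv_ob V) (m n : src_ker V).

Definition nc_dif : {linear src_ker V -> tv_ob V} := tgt \o @ker_ar K V.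

Definition nc_l01_fun x m : src_ker V := ker_arr ⟪1_x, ker_ar m⟫.
Definition nc_l10_fun m x : src_ker V := ker_arr ⟪ker_ar m, 1_x⟫.

Fact nc_l01_linl m : linear (nc_l01_fun^~ m).
Proof. by move=> a u v; rewrite /nc_l01_fun !(linearP, linearPl). Qed.
Fact nc_l01_linr x : linear (nc_l01_fun x).
Proof. by move=> a u v; rewrite /nc_l01_fun !(linearP, linearPl). Qed.
Fact nc_l10_linl x : linear (nc_l10_fun^~ x).
Proof. by move=> a u v; rewrite /nc_l10_fun !(linearP, linearPl). Qed.
Fact nc_l10_linr m : linear (nc_l10_fun m).
Proof. by move=> a u v; rewrite /nc_l10_fun !(linearP, linearPl). Qed.

Definition nc_l01 := bilinear_pack nc_l01_linl nc_l01_linr.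
Definition nc_l10 := bilinear_pack nc_l10_linl nc_l10_linr.
Definition nc_l3 x y z : src_ker V := ker_arr (jac x y z).

Fact nc_l3_trilinear : trilinear nc_l3.
Proof.
have [l1 l2 l3] := jac_trilinear V.
split=> [v w|u w|u v] a p q; rewrite /nc_l3.
- by rewrite l1 linearP.
- by rewrite l2 linearP.
- by rewrite l3 linearP.
Qed.

Lemma ker_ar_l01 x m : ker_ar (nc_l01 x m) = ⟪1_x, ker_ar m⟫.
Proof. exact: brk_kerr. Qed.
Lemma ker_ar_l10 m x : ker_ar (nc_l10 m x) = ⟪ker_ar m, 1_x⟫.
Proof. exact: brk_kerl. Qed.
Lemma ker_ar_l3 x y z : ker_ar (nc_l3 x y z) = arr (jac x y z).
Proof. by []. Qed.

Lemma tgt_ker m : tgt (ker_ar m) = nc_dif m.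
Proof. by []. Qed.

Lemma jac0 : (forall y z, jac 0 y z = 0 :> tv_ar V) /\
  (forall x z, jac x 0 z = 0 :> tv_ar V) /\
  (forall x y, jac x y 0 = 0 :> tv_ar V).
Proof.
have lin0 (f : tv_ob V -> tv_ar V) : linear f -> f 0 = 0.
  by move=> lf; have := lf (-1) 0 0; rewrite scaler0 addr0 scaleN1r addNr.
have [l1 l2 l3] := jac_trilinear V.
split=> [y z|]; first exact: (lin0 (fun u => jac u y z)).
split=> [x z|x y]; first exact: (lin0 (fun u => jac x u z)).
exact: lin0.
Qed.

Lemma arr0 : arr (0 : tv_ar V) = 0.
Proof. by rewrite arr.unlock !linear0 addr0. Qed.

(** The three identities for [l3] of a boundary are the naturality squares of
    the Jacobiator at one kernel element [m] and two identities: as [src m = 0],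
    the Jacobiator at the sources vanishes, and at the targets it is evaluated
    at [d m]. *)
Definition nc_sh_leib : sh_leib K.
Proof.
apply: (@ShLeib K _ _ nc_dif (br_ob (brk V)) nc_l01 nc_l10 nc_l3
  nc_l3_trilinear).
- by move=> x m; rewrite -!tgt_ker ker_ar_l01 br_tgt tgt_idar.
- by move=> m x; rewrite -!tgt_ker ker_ar_l10 br_tgt tgt_idar.
- move=> m n; apply: ker_ar_inj; rewrite ker_ar_l01 ker_ar_l10.
  by rewrite -(brk_ker m n).1 (brk_ker m n).2.
- by move=> x y z; rewrite -tgt_ker tgt_arr tgt_jac src_jac; zmod.
- move=> x y m; apply: ker_ar_inj.
  have := arr_jac_natural 1_x 1_y (ker_ar m).
  rewrite !src_idar !tgt_idar src_ker_ar jac0.2.2 !br_idar.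
  rewrite !(ker_arB, ker_arN) !(ker_ar_l01, ker_ar_l10) -!ker_ar_l3 /=.
  rewrite !(arr_br1l, arr_br1r, arr_ker_ar, arr0) tgt_ker -ker_ar_l3 => e.
  by apply: (zmod_comb (esym e)); zmod.
- move=> x m y; apply: ker_ar_inj.
  have := arr_jac_natural 1_x (ker_ar m) 1_y.
  rewrite !src_idar !tgt_idar src_ker_ar jac0.2.1 !br_idar.
  rewrite !(ker_arB, ker_arN) !(ker_ar_l01, ker_ar_l10) -!ker_ar_l3 /=.
  rewrite !(arr_br1l, arr_br1r, arr_ker_ar, arr0) tgt_ker -ker_ar_l3 => e.
  by apply: (zmod_comb (esym e)); zmod.
- move=> m x y; apply: ker_ar_inj.
  have := arr_jac_natural (ker_ar m) 1_x 1_y.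
  rewrite !src_idar !tgt_idar src_ker_ar jac0.1 !br_idar.
  rewrite !(ker_arB, ker_arN) !(ker_ar_l01, ker_ar_l10) -!ker_ar_l3 /=.
  rewrite !(arr_br1l, arr_br1r, arr_ker_ar, arr0) tgt_ker -ker_ar_l3 => e.
  by apply: (zmod_comb (esym e)); zmod.
- move=> x y z w; apply: ker_ar_inj; have e := arr_jac_coherence x y z w.
  rewrite !(ker_arB, ker_arD) !(ker_ar_l01, ker_ar_l10) !ker_ar_l3.
  by apply: (zmod_comb e); zmod.
Defined.

End NormalizedComplex.

Section KernelMaps.
Context (K : fieldType).

Definition ker_functor (V W : two_vect K) (F : lin_functor V W) :
    {linear src_ker V -> src_ker W} :=
  @ker_arr K W \o on_ar F \o @ker_ar K V.

Lemma ker_ar_functor (V W : two_vect K) (F : lin_functor V W) m :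
  ker_ar (ker_functor F m) = on_ar F (ker_ar m).
Proof. by rewrite /= arr_on_ar arr_ker_ar. Qed.

Lemma ker_functor_dif (V W : leib2 K) (F : lin_functor V W) m :
  nc_dif W (ker_functor F m) = on_ob F (nc_dif V m).
Proof. by rewrite -!tgt_ker ker_ar_functor on_tgt. Qed.

Context (V : two_vect K) (U U' : lmodType K).

Definition ker_lin (f : {linear U -> tv_ar V}) : {linear U -> src_ker V} :=
  @ker_arr K V \o f.

Lemma ker_ar_lin f u : ker_ar (ker_lin f u) = arr (f u).
Proof. by []. Qed.

Context (f : {bilinear U -> U' -> tv_ar V}).

Fact ker_bilin_linl v : linear (fun u => ker_arr (f u v)).
Proof. by move=> a u u'; rewrite !(linearP, linearPl). Qed.
Fact ker_bilin_linr u : linear (fun v => ker_arr (f u v)).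
Proof. by move=> a v v'; rewrite !linearP. Qed.
Definition ker_bilin := bilinear_pack ker_bilin_linl ker_bilin_linr.

Lemma ker_ar_bilin u v : ker_ar (ker_bilin u v) = arr (f u v).
Proof. by []. Qed.

Fact ker_bilinN_linl v : linear (fun u => - ker_arr (f u v)).
Proof. by move=> a u u'; rewrite !(linearP, linearPl). Qed.
Fact ker_bilinN_linr u : linear (fun v => - ker_arr (f u v)).
Proof. by move=> a v v'; rewrite !linearP. Qed.
(** The sign-reversed kernel component, for the transformation of a
    2-derivation: it runs from the image of the bracket to the brackets of the
    images, opposite to the convention for [th2]. *)
Definition ker_bilinN := bilinear_pack ker_bilinN_linl ker_bilinN_linr.

Lemma ker_ar_bilinN u v : ker_ar (ker_bilinN u v) = - arr (f u v).
Proof. by rewrite ker_arN. Qed.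

End KernelMaps.

Definition kerE := (@ker_arD, @ker_arB, @ker_arN, @ker_ar_l01, @ker_ar_l10,
  @ker_ar_l3, @ker_ar_functor, @ker_ar_lin, @ker_ar_bilin,
  @ker_ar_bilinN).

Section NormalizedDerivation.
Context (K : fieldType) (V : leib2 K) (D : two_derivation V).
Local Notation A := (nc_sh_leib V).

Definition nc_derivation : homotopy_derivation A.
Proof.
apply: (@HomotopyDerivation K A (on_ob D) (ker_functor D) (ker_bilinN (dtr D))).
- exact: ker_functor_dif.
- move=> x y; rewrite -[LHS]tgt_ker ker_ar_bilinN linearN /= tgt_arr.
  by rewrite src_dtr tgt_dtr; zmod.
- move=> x m; apply: ker_ar_inj; have := arr_dtr_natural D 1_x (ker_ar m).
  rewrite src_ker_ar linear0r arr0 tgt_idar on_idar !arr_br1l.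
  rewrite !arr_on_ar !arr_ker_ar => e.
  rewrite !kerE -[dif _ m]tgt_ker.
  by apply: (zmod_comb (esym e)); zmod.
- move=> m x; apply: ker_ar_inj; have := arr_dtr_natural D (ker_ar m) 1_x.
  rewrite src_ker_ar linear0l arr0 tgt_idar on_idar !arr_br1r.
  rewrite !arr_on_ar !arr_ker_ar => e.
  rewrite !kerE -[dif _ m]tgt_ker.
  by apply: (zmod_comb (esym e)); zmod.
- move=> x y z; apply: ker_ar_inj; have e := arr_dtr_coherence D x y z.
  rewrite !kerE !(linearNr, linearNl).
  by apply: (zmod_comb (esym e)); zmod.
Defined.

End NormalizedDerivation.

Definition nc_leibder (K : fieldType) (V : leibder2 K) : sh_leibder K :=
  ShLeibDer (nc_derivation (ld_der V)).

Section NormalizedHom.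
Context (K : fieldType) (V W : leib2 K) (F : leib2_hom V W).

Definition nc_hom : sh_hom (nc_sh_leib V) (nc_sh_leib W).
Proof.
apply: (@ShHom K (nc_sh_leib V) (nc_sh_leib W)
  (on_ob F) (ker_functor F) (ker_bilin (hom2 F))).
- exact: ker_functor_dif.
- move=> x y; rewrite -[LHS]tgt_ker ker_ar_bilin tgt_arr.
  by rewrite src_hom2 tgt_hom2.
- move=> x m; apply: ker_ar_inj; have := arr_hom2_natural F 1_x (ker_ar m).
  rewrite src_ker_ar linear0r arr0 tgt_idar on_idar !arr_br1l.
  rewrite !arr_on_ar !arr_ker_ar => e.
  rewrite !kerE -[dif _ m]tgt_ker.
  by apply: (zmod_comb e); zmod.
- move=> m x; apply: ker_ar_inj; have := arr_hom2_natural F (ker_ar m) 1_x.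
  rewrite src_ker_ar linear0l arr0 tgt_idar on_idar !arr_br1r.
  rewrite !arr_on_ar !arr_ker_ar => e.
  rewrite !kerE -[dif _ m]tgt_ker.
  by apply: (zmod_comb e); zmod.
- move=> x y z; apply: ker_ar_inj; have e := arr_hom2_coherence F x y z.
  rewrite !kerE -[ker_ar 0]/0.
  by apply: (zmod_comb (esym e)); zmod.
Defined.

End NormalizedHom.

Section NormalizedPairHom.
Context (K : fieldType) (V W : leibder2 K) (F : leibder2_hom V W).

Definition nc_leibder_hom : sh_leibder_hom (nc_leibder V) (nc_leibder W).
Proof.
apply: (@ShLeibDerHom K (nc_leibder V) (nc_leibder W) (nc_hom F)
  (ker_lin (phi F))).
- by move=> x; rewrite -[RHS]tgt_ker /= tgt_arr src_phi tgt_phi.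
- move=> m; apply: ker_ar_inj; have := arr_phi_natural F (ker_ar m).
  rewrite src_ker_ar linear0 arr0 arr_ker_ar => e.
  rewrite !kerE -[dif _ m]tgt_ker.
  by apply: (zmod_comb (esym e)); zmod.
- move=> x y; apply: ker_ar_inj; have e := arr_phi_coherence F x y.
  rewrite !kerE [on_ar F _]linearN.
  by apply: (zmod_comb (esym e)); zmod.
Defined.

End NormalizedPairHom.

Definition normalization (K : fieldType) :
  functor (LeibDer2_cat K) (TwoLeibDerInfty_cat K).
Proof.
exists (@nc_leibder K) (@nc_leibder_hom K).
- move=> V; apply: sh_leibder_hom_ext => [x|m|x y|x] //=; apply: ker_ar_inj.
  + by rewrite /= arr_ker_ar.
  + by rewrite /= arr_idar.
  + by rewrite /= arr_idar.
- move=> U V W F G; apply: sh_leibder_hom_ext => [x|m|x y|x] //=;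
    apply: ker_ar_inj.
  + by rewrite /= !arr_on_ar !arr_ker_ar.
  + by rewrite /= arr_hom2_comp arr_on_ar arr_idem.
  + by rewrite ker_arD /= arr_phi_comp arr_on_ar arr_idem.
Defined.

(** * Fullness: lifting morphisms along normalization *)

Section ArrowDecomposition.
Context (K : fieldType) (V : two_vect K).

Definition mk_ar (x : tv_ob V) (m : src_ker V) : tv_ar V := idar V x + ker_ar m.

Lemma src_mk_ar x m : src (mk_ar x m) = x.
Proof. by rewrite /mk_ar linearD src_idar src_ker_ar addr0. Qed.

Lemma tgt_mk_ar x m : tgt (mk_ar x m) = x + tgt (ker_ar m).
Proof. by rewrite /mk_ar linearD tgt_idar. Qed.

Lemma ker_mk_ar x m : ker_arr (mk_ar x m) = m.
Proof.
apply: ker_ar_inj; rewrite ker_arrK /mk_ar arrD arr_idar add0r.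
exact: arr_ker_ar.
Qed.

Lemma mk_arK (f : tv_ar V) : mk_ar (src f) (ker_arr f) = f.
Proof. exact: idar_arr. Qed.

Lemma ar_ext (f g : tv_ar V) : src f = src g -> ker_arr f = ker_arr g -> f = g.
Proof. by move=> e1 e2; rewrite -(mk_arK f) -(mk_arK g) e1 e2. Qed.

Lemma ker_arr_comp (f g : tv_ar V) :
  tgt f = src g -> ker_arr (f ;; g) = ker_arr f + ker_arr g.
Proof. by move=> fg; apply: ker_ar_inj; rewrite ker_arD !ker_arrK arr_comp. Qed.

Lemma ker_arrD (f g : tv_ar V) : ker_arr (f + g) = ker_arr f + ker_arr g.
Proof. exact: linearD. Qed.

Lemma ker_arr_idar x : ker_arr (idar V x) = 0.
Proof. by apply: ker_ar_inj; rewrite ker_arrK arr_idar. Qed.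

Lemma mk_ar_linear (U : lmodType K) (x : U -> tv_ob V) (m : U -> src_ker V) :
  linear x -> linear m -> linear (fun u => mk_ar (x u) (m u)).
Proof.
move=> lx lm a u v; rewrite /mk_ar lx lm linearP (ker_ar_linear a) /=.
by rewrite scalerDr addrACA.
Qed.

End ArrowDecomposition.

Section KernelBracket.
Context (K : fieldType) (V : leib2 K).
Local Notation A := (nc_sh_leib V).

Lemma tgt_ker_arr (f : tv_ar V) : dif A (ker_arr f) = tgt f - src f.
Proof. by rewrite -[LHS]tgt_ker ker_arrK tgt_arr. Qed.

Lemma ker_brk (f g : tv_ar V) : ker_arr ⟪f, g⟫ =
  l01 A (tgt f) (ker_arr g) + l10 A (ker_arr f) (src g).
Proof.
by apply: ker_ar_inj; rewrite ker_arD ker_ar_l01 ker_ar_l10 !ker_arrK arr_brk.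
Qed.

Lemma ker_brkr x (g : tv_ar V) : ker_arr ⟪1_x, g⟫ = l01 A x (ker_arr g).
Proof. by rewrite ker_brk tgt_idar ker_arr_idar linear0l addr0. Qed.

Lemma ker_brkl (f : tv_ar V) x : ker_arr ⟪f, 1_x⟫ = l10 A (ker_arr f) x.
Proof. by rewrite ker_brk src_idar ker_arr_idar linear0r add0r. Qed.

Lemma ker_jac x y z : ker_arr (jac x y z) = @l3 K A x y z.
Proof. by []. Qed.

End KernelBracket.

Section LiftFunctor.
Context (K : fieldType) (V W : leib2 K).
Context (h : sh_hom (nc_sh_leib V) (nc_sh_leib W)).

Definition lift_ar : {linear tv_ar V -> tv_ar W} :=
  linear_pack (mk_ar_linear (linearP (sf0 h \o src))
                            (linearP (sf1 h \o @ker_arr K V))).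

Lemma ker_lift_ar f : ker_arr (lift_ar f) = sf1 h (ker_arr f).
Proof. exact: ker_mk_ar. Qed.

Lemma src_lift_ar f : src (lift_ar f) = sf0 h (src f).
Proof. exact: src_mk_ar. Qed.

Lemma tgt_lift_ar f : tgt (lift_ar f) = sf0 h (tgt f).
Proof.
have e := sf_dif h (ker_arr f); rewrite tgt_ker_arr linearB in e.
by rewrite [LHS]tgt_mk_ar [tgt _]e /= addrC subrK.
Qed.

Definition lift_functor : lin_functor V W.
Proof.
apply: (@LinFunctor K V W (sf0 h) lift_ar src_lift_ar tgt_lift_ar).
- move=> x; apply: ar_ext; first by rewrite src_lift_ar !src_idar.
  by rewrite ker_lift_ar !ker_arr_idar linear0.
- have cmp f g : tgt f = src g -> tgt (lift_ar f) = src (lift_ar g).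
    by move=> fg; rewrite tgt_lift_ar src_lift_ar fg.
  move=> f g fg; have fg' := cmp _ _ fg; apply: ar_ext.
    by rewrite src_comp // !src_lift_ar src_comp.
  by rewrite !ker_arr_comp // !ker_lift_ar ker_arr_comp // linearD.
Defined.

Fact lift2_linl y :
  linear (fun x => mk_ar ⟦sf0 h x, sf0 h y⟧ (sf2 h x y)).
Proof. by apply: mk_ar_linear => a u v; rewrite !(linearPl, linearP). Qed.

Fact lift2_linr x :
  linear (fun y => mk_ar ⟦sf0 h x, sf0 h y⟧ (sf2 h x y)).
Proof. by apply: mk_ar_linear => a u v; rewrite !linearP. Qed.

Definition lift2 : {bilinear tv_ob V -> tv_ob V -> tv_ar W} :=
  bilinear_pack lift2_linl lift2_linr.

Lemma ker_lift2 x y : ker_arr (lift2 x y) = sf2 h x y.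
Proof. exact: ker_mk_ar. Qed.

Lemma src_lift2 x y : src (lift2 x y) = ⟦sf0 h x, sf0 h y⟧.
Proof. exact: src_mk_ar. Qed.

Lemma tgt_lift2 x y : tgt (lift2 x y) = sf0 h ⟦x, y⟧.
Proof.
by rewrite [LHS]tgt_mk_ar [tgt _](dif_sf2 h x y) /= addrC subrK.
Qed.

(** Splitting both arrows by [ker_brk] reduces naturality at arbitrary [f], [g]
    to [sf2_difr] at the target of [f] and [sf2_difl] at the source of [g]. *)
Fact lift2_natural (f g : tv_ar V) :
  ⟪lift_ar f, lift_ar g⟫ ;; lift2 (tgt f) (tgt g) =
  lift2 (src f) (src g) ;; lift_ar ⟪f, g⟫.
Proof.
(* Only the endpoints and kernel components of the lifts matter from here on. *)
move: src_lift_ar tgt_lift_ar ker_lift_ar src_lift2 tgt_lift2 ker_lift2.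
move: lift_ar lift2 => L M sL tL kL sM tM kM.
pose E := (sL, tL, sM, tM, @br_src K V, @br_tgt K V).
have n1 := sf2_difr h (tgt f) (ker_arr g).
have n2 := sf2_difl h (ker_arr f) (src g).
apply: ar_ext; first by endpoints W E.
rewrite !ker_arr_comp; [|endpoints W E ..].
rewrite !kM !kL !ker_brk !kL sL tL.
rewrite linearD; rewrite !tgt_ker_arr linearBl linearB /= in n1 n2.
by apply: (zmod_comb n1); apply: (zmod_comb n2); zmod.
Qed.

Fact lift2_coherence x y z :
  jac (sf0 h x) (sf0 h y) (sf0 h z) ;;
    (⟪lift2 x z, 1_(sf0 h y)⟫ + ⟪1_(sf0 h x), lift2 y z⟫) ;;
    (lift2 ⟦x, z⟧ y + lift2 x ⟦y, z⟧) =
  ⟪lift2 x y, 1_(sf0 h z)⟫ ;; lift2 ⟦x, y⟧ z ;; lift_ar (jac x y z).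
Proof.
move: src_lift_ar tgt_lift_ar ker_lift_ar src_lift2 tgt_lift2 ker_lift2.
move: lift_ar lift2 => L M sL tL kL sM tM kM.
pose E := (sL, tL, sM, tM, @src_jac K V, @src_jac K W, @tgt_jac K W).
have e := sf2_coherence h x y z.
apply: ar_ext; first by endpoints W E.
rewrite !ker_arr_comp; [|endpoints W E ..].
rewrite !ker_arrD !ker_brkl !ker_brkr !kL !kM !ker_jac.
by apply: (zmod_comb (esym e)); zmod.
Qed.

Definition lift_hom : leib2_hom V W :=
  @Leib2Hom K V W lift_functor lift2 src_lift2 tgt_lift2
    lift2_natural lift2_coherence.

End LiftFunctor.

Lemma ker_on_ar (K : fieldType) (V W : two_vect K) (F : lin_functor V W) f :
  ker_arr (on_ar F f) = ker_functor F (ker_arr f).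
Proof. by apply: ker_ar_inj; rewrite ker_ar_functor !ker_arrK arr_on_ar. Qed.

Lemma ker_dtr (K : fieldType) (V : leib2 K) (D : two_derivation V) x y :
  ker_arr (dtr D x y) = - th2 (nc_derivation D) x y.
Proof. by rewrite /= opprK. Qed.

Section LiftPair.
Context (K : fieldType) (V W : leibder2 K).
Context (h : sh_leibder_hom (nc_leibder V) (nc_leibder W)).
Local Notation F := (lift_hom h).
Local Notation DV := (ld_der V).
Local Notation DW := (ld_der W).

Fact lift_phi_linear : linear (fun x => mk_ar (on_ob DW (sf0 h x)) (sB h x)).
Proof. by apply: mk_ar_linear => a u v; rewrite !linearP. Qed.

Definition lift_phi : {linear tv_ob V -> tv_ar W} :=
  linear_pack lift_phi_linear.

Lemma ker_lift_phi x : ker_arr (lift_phi x) = sB h x.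
Proof. exact: ker_mk_ar. Qed.

Lemma src_lift_phi x : src (lift_phi x) = on_ob DW (sf0 h x).
Proof. exact: src_mk_ar. Qed.

Lemma tgt_lift_phi x : tgt (lift_phi x) = sf0 h (on_ob DV x).
Proof.
by rewrite [LHS]tgt_mk_ar [tgt _](esym (dif_sB h x)) /= addrC subrK.
Qed.

Fact lift_phi_natural (f : tv_ar V) :
  on_ar DW (lift_ar h f) ;; lift_phi (tgt f) =
  lift_phi (src f) ;; lift_ar h (on_ar DV f).
Proof.
move: (src_lift_ar h) (tgt_lift_ar h) (ker_lift_ar h).
move: src_lift_phi tgt_lift_phi ker_lift_phi.
move: (lift_ar h) lift_phi => L P sP tP kP sL tL kL.
pose E := (sL, tL, sP, tP, @on_src K V V DV, @on_src K W W DW,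
  @on_tgt K W W DW).
have n := sB_dif h (ker_arr f).
apply: ar_ext; first by endpoints W E.
rewrite !ker_arr_comp; [|endpoints W E ..].
rewrite ker_on_ar !kP !kL ker_on_ar.
rewrite tgt_ker_arr linearB in n.
by apply: (zmod_comb (esym n)); zmod.
Qed.

Fact lift_phi_coherence (x y : tv_ob V) :
  on_ar DW (lift2 h x y) ;; lift_phi ⟦x, y⟧ ;; lift_ar h (dtr DV x y) =
  dtr DW (sf0 h x) (sf0 h y) ;;
    (⟪lift_phi x, 1_(sf0 h y)⟫ + ⟪1_(sf0 h x), lift_phi y⟫) ;;
    (lift2 h (on_ob DV x) y + lift2 h x (on_ob DV y)).
Proof.
move: (src_lift_ar h) (tgt_lift_ar h) (ker_lift_ar h).
move: (src_lift2 h) (tgt_lift2 h) (ker_lift2 h).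
move: src_lift_phi tgt_lift_phi ker_lift_phi.
move: (lift_ar h) (lift2 h) lift_phi => L M P sP tP kP sM tM kM sL tL kL.
pose E := (sL, tL, sM, tM, sP, tP, @on_src K W W DW, @on_tgt K W W DW,
  @src_dtr K V DV, @src_dtr K W DW, @tgt_dtr K W DW).
have e := sB_coherence h x y.
apply: ar_ext; first by endpoints W E.
rewrite !ker_arr_comp; [|endpoints W E ..].
rewrite !ker_arrD ker_on_ar !ker_brkl !ker_brkr !kL !kM !kP !ker_dtr linearN.
by apply: (zmod_comb (esym e)); zmod.
Qed.

Definition lift_leibder_hom : leibder2_hom V W :=
  @LeibDer2Hom K V W F lift_phi src_lift_phi tgt_lift_phi
    lift_phi_natural (fun x => is_iso_arT _) lift_phi_coherence.

End LiftPair.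

Lemma lift_leibder_homK (K : fieldType) (V W : leibder2 K)
    (h : sh_leibder_hom (nc_leibder V) (nc_leibder W)) :
  nc_leibder_hom (lift_leibder_hom h) = h.
Proof.
apply: sh_leibder_hom_ext => [x|m|x y|x] //.
- by rewrite [LHS](ker_lift_ar h) ker_ar_arrK.
- exact: ker_lift2.
- exact: ker_lift_phi.
Qed.

Lemma nc_leibder_homK (K : fieldType) (V W : leibder2 K)
    (F : leibder2_hom V W) :
  lift_leibder_hom (nc_leibder_hom F) = F.
Proof.
apply: leibder2_hom_ext => [x|f|x y|x] //; apply: ar_ext.
- exact: etrans (src_lift_ar (nc_leibder_hom F) f) (esym (on_src F f)).
- exact: etrans (ker_lift_ar (nc_leibder_hom F) f) (esym (ker_on_ar F f)).
- exact: etrans (src_lift2 (nc_leibder_hom F) x y) (esym (src_hom2 F x y)).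
- exact: (ker_lift2 (nc_leibder_hom F)).
- exact: etrans (src_lift_phi (nc_leibder_hom F) x) (esym (src_phi F x)).
- exact: (ker_lift_phi (nc_leibder_hom F)).
Qed.

(** * Essential surjectivity: the pair built from a complex *)

Section ComplexVect.
Context (K : fieldType) (A1 A0 : lmodType K) (d : {linear A1 -> A0}).
Local Notation ar := (A0 * A1)%type.

Fact cv_src_linear : linear (fun f : ar => f.1). Proof. by []. Qed.
Definition cv_src : {linear ar -> A0} := linear_pack cv_src_linear.

Fact cv_tgt_linear : linear (fun f : ar => f.1 + d f.2).
Proof. by move=> a f g /=; rewrite linearP scalerDr addrACA. Qed.
Definition cv_tgt : {linear ar -> A0} := linear_pack cv_tgt_linear.

Fact cv_id_linear : linear (fun x : A0 => (x, 0) : ar).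
Proof.
move=> a x y; congr pair.
by rewrite /= scaler0 addr0.
Qed.
Definition cv_id : {linear A0 -> ar} := linear_pack cv_id_linear.

Definition cv_comp_fun (p : pullback cv_src cv_tgt) : ar :=
  ((val p).1.1, (val p).1.2 + (val p).2.2).
Fact cv_comp_linear : linear cv_comp_fun.
Proof.
move=> a p q; rewrite /cv_comp_fun linearP; congr pair.
by rewrite /= scalerDr addrACA.
Qed.
Definition cv_comp : {linear pullback cv_src cv_tgt -> ar} :=
  linear_pack cv_comp_linear.

Lemma cv_seq_comp f g : cv_tgt f = cv_src g ->
  seq_comp cv_comp f g = (f.1, f.2 + g.2).
Proof.
move=> fg; have fg' : (f, g) \in composable cv_src cv_tgt.
  by rewrite inE; apply/eqP.
by rewrite /seq_comp insubT.
Qed.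

Definition complex_vect : two_vect K.
Proof.
apply: (@TwoVect K A0 ar cv_src cv_tgt cv_id cv_comp).
- by [].
- by move=> x /=; rewrite linear0 addr0.
- by [].
- case=> p /=; rewrite inE => /eqP /= e.
  by rewrite linearD addrA e.
- move=> f; rewrite cv_seq_comp /=; last by rewrite linear0 addr0.
  by rewrite add0r -surjective_pairing.
- move=> f; rewrite cv_seq_comp //= addr0.
  by rewrite -surjective_pairing.
- move=> f g h fg gh; rewrite (cv_seq_comp gh) (cv_seq_comp fg).
  rewrite !cv_seq_comp /= ?addrA //.
  by rewrite linearD addrA; move: fg => /= ->.
Defined.

Lemma cv_comp2 (f g : tv_ar complex_vect) :
  tgt f = src g -> (f ;; g).2 = f.2 + g.2.
Proof. by move=> fg; rewrite (cv_seq_comp fg). Qed.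

Lemma cv_ext (f g : tv_ar complex_vect) : src f = src g -> f.2 = g.2 -> f = g.
Proof. by case: f g => [x m] [y n] /= -> ->. Qed.

End ComplexVect.

Section ComplexLeib.
Context (K : fieldType) (A : sh_leib K).
Local Notation V := (complex_vect (dif A)).
Local Notation d := (dif A).

(** The formula is forced by [arr_brk]: functoriality would fail without the
    target of [f] in the first term. *)
Definition cv_brk_fun (f g : tv_ar V) : tv_ar V :=
  (l00 A f.1 g.1, l01 A (f.1 + d f.2) g.2 + l10 A f.2 g.1).

Fact cv_brk_linl g : linear (cv_brk_fun^~ g).
Proof.
move=> a f f'; rewrite /cv_brk_fun /= !(linearPl, linearP) /=; congr pair.
rewrite /= ?(linearDl, linearPl, linearP) /= !linearZl_LR /= !scalerDr; zmod.
Qed.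

Fact cv_brk_linr f : linear (cv_brk_fun f).
Proof.
move=> a g g'; rewrite /cv_brk_fun /= !linearPr /=; congr pair.
by rewrite /= !scalerDr; zmod.
Qed.

Definition cv_brk_ar := bilinear_pack cv_brk_linl cv_brk_linr.

Fact cv_brk_tgt f g : tgt (cv_brk_ar f g) = l00 A (tgt f) (tgt g).
Proof.
case: f g => [x m] [y n] /=.
by rewrite linearD /= dif_l01 dif_l10 !linearDr !linearDl /=; zmod.
Qed.

Fact cv_brk_comp f f' g g' : tgt f = src f' -> tgt g = src g' ->
  cv_brk_ar (f ;; f') (g ;; g') = cv_brk_ar f g ;; cv_brk_ar f' g'.
Proof.
move=> ff gg; have e : tgt (cv_brk_ar f g) = src (cv_brk_ar f' g').
  by rewrite cv_brk_tgt ff gg.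
rewrite (cv_seq_comp ff) (cv_seq_comp gg) (cv_seq_comp e).
move: ff gg {e}; case: f f' g g' => [x m] [x' m'] [y n] [y' n'] /= <- <-.
congr pair; rewrite /= !linearD /= !linearDl /= !l01_dif.
zmod.
Qed.

Definition complex_brk : bilin_functor V.
Proof.
apply: (@BilinFunctor K V (l00 A) cv_brk_ar) => //.
- exact: cv_brk_tgt.
- by move=> x y; congr pair; rewrite /= linear0r linear0l addr0.
- exact: cv_brk_comp.
Defined.

Definition cv_jac (x y z : sh0 A) : tv_ar V := (l00 A (l00 A x y) z, l3 x y z).

Fact cv_jac_trilinear : trilinear cv_jac.
Proof.
have [l1 l2 l3] := l3_trilinear A.
split=> [v w|u w|u v] a p q; rewrite /cv_jac.
- by rewrite l1 !linearPl.
- by rewrite l2 linearPr linearPl.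
- by rewrite l3 linearPr.
Qed.

Fact tgt_cv_jac x y z : tgt (cv_jac x y z) =
  l00 A (l00 A x z) y + l00 A x (l00 A y z).
Proof.
rewrite /=; have e := dif_l3 x y z.
by apply: (zmod_comb (esym e)); zmod.
Qed.

Lemma cv_brk2 (f g : tv_ar V) :
  (cv_brk_ar f g).2 = l01 A (tgt f) g.2 + l10 A f.2 g.1.
Proof. by []. Qed.

(** Telescoping [l3] from the sources to the targets, one argument at a time and
    from left to right, so that each step is an instance of one of [l3_dif1],
    [l3_dif2], [l3_dif3]. *)
Lemma l3_tgt x y z m n p :
  l3 (x + d m) (y + d n) (z + d p) = l3 x y z + l3 (d m) y z +
    l3 (x + d m) (d n) z + l3 (x + d m) (y + d n) (d p).
Proof.
have [l1 l2 l3l] := l3_trilinear A.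
have := l3l (x + d m) (y + d n) 1 z (d p); rewrite !scale1r => ->.
have := l2 (x + d m) z 1 y (d n); rewrite !scale1r => ->.
by have := l1 y z 1 x (d m); rewrite !scale1r => ->.
Qed.

Fact cv_jac_natural : jacobiator_natural complex_brk cv_jac.
Proof.
move=> f g h; pose E := (cv_brk_tgt, tgt_cv_jac).
apply: cv_ext; first by endpoints (complex_vect d) E.
rewrite !cv_comp2; [|endpoints (complex_vect d) E ..].
case: f g h => [x m] [y n] [z p] {E}.
rewrite ![(_ + _).2]/= !cv_brk2 !cv_brk_tgt /=.
have e3 := l3_dif3 (x + d m) (y + d n) p.
have e2 := l3_dif2 (x + d m) n z.
have e1 := l3_dif1 m y z.
(* Moving the last argument changes [y] into [y + d n] in a bracket of the two
   degree 1 elements, which is compensated by this instance. *)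
have e0 := l01_dif (l01 A (x + d m) p) n; rewrite dif_l01 in e0.
have et := l3_tgt x y z m n p.
rewrite ?linearD /= ?linearDl /= ?linearD /= in e0 e1 e2 e3 *.
rewrite !dif_l01 !dif_l10 ?linearDl /= in e0 e1 e2 e3 *.
apply: (zmod_comb (esym e0)); apply: (zmod_comb (esym e1)).
apply: (zmod_comb (esym e2)); apply: (zmod_comb (esym e3)).
by apply: (zmod_comb et); zmod.
Qed.

Fact cv_jac_coherence : jacobiator_coherence complex_brk cv_jac.
Proof.
move=> x y z w; pose E := (cv_brk_tgt, tgt_cv_jac).
apply: cv_ext; first by endpoints (complex_vect d) E.
rewrite !cv_comp2; [|endpoints (complex_vect d) E ..].
have e := l3_coherence x y z w.
rewrite /= ?(linear0, addr0, linear0r, linear0l, add0r).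
by apply: (zmod_comb e); zmod.
Qed.

Definition complex_leib : leib2 K :=
  @Leib2 K V complex_brk cv_jac cv_jac_trilinear (fun _ _ _ => erefl) tgt_cv_jac
    cv_jac_natural (fun _ _ _ => is_iso_arT _) cv_jac_coherence.

End ComplexLeib.

Section ComplexDerivation.
Context (K : fieldType) (A : sh_leib K) (T : homotopy_derivation A).
Local Notation V := (complex_leib A).
Local Notation d := (dif A).

Fact cv_der_linear :
  linear (fun f : tv_ar V => (th0 T f.1, th1 T f.2) : tv_ar V).
Proof. by move=> a f g; congr pair; rewrite /= linearP. Qed.
Definition cv_der_ar := linear_pack cv_der_linear.

Lemma tgt_cv_der f : tgt (cv_der_ar f) = th0 T (tgt f).
Proof. by rewrite /= linearD th_dif. Qed.

Definition complex_der : lin_functor V V.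
Proof.
apply: (@LinFunctor K V V (th0 T) cv_der_ar) => //.
- exact: tgt_cv_der.
- by move=> x; congr pair; rewrite linear0.
- move=> f g fg; have e : tgt (cv_der_ar f) = src (cv_der_ar g).
    by rewrite tgt_cv_der fg.
  rewrite (cv_seq_comp fg) (cv_seq_comp e); congr pair.
  by rewrite /= linearD.
Defined.

Fact cv_dtr_linl y :
  linear (fun x => (th0 T (l00 A x y), - th2 T x y) : tv_ar V).
Proof.
move=> a u v; rewrite !linearPl linearP; congr pair.
by rewrite /= scalerN opprD.
Qed.

Fact cv_dtr_linr x :
  linear (fun y => (th0 T (l00 A x y), - th2 T x y) : tv_ar V).
Proof.
move=> a u v; rewrite !linearPr linearP; congr pair.
by rewrite /= scalerN opprD.
Qed.

Definition cv_dtr : {bilinear sh0 A -> sh0 A -> tv_ar V} :=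
  bilinear_pack cv_dtr_linl cv_dtr_linr.

Lemma tgt_cv_dtr x y : tgt (cv_dtr x y) = l00 A (th0 T x) y + l00 A x (th0 T y).
Proof. by rewrite /= linearN /= dif_th2; zmod. Qed.

Fact cv_dtr_natural f g :
  cv_der_ar ⟪f, g⟫ ;; cv_dtr (tgt f) (tgt g) =
  cv_dtr (src f) (src g) ;; (⟪cv_der_ar f, g⟫ + ⟪f, cv_der_ar g⟫).
Proof.
pose E := (tgt_cv_der, tgt_cv_dtr, @cv_brk_tgt K A).
apply: cv_ext; first by endpoints (complex_vect d) E.
rewrite !cv_comp2; [|endpoints (complex_vect d) E ..].
case: f g => [x m] [y n] {E}.
have e1 := th2_difr T (x + d m) n.
have e2 := th2_difl T m y.
rewrite /= ?linearD /= ?linearDl /= ?linearD /= ?linearDl /= in e1 e2 *.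
rewrite -?th_dif in e1.

by apply: (zmod_comb (esym e1)); apply: (zmod_comb (esym e2)); zmod.
Qed.

Fact cv_dtr_coherence (x y z : tv_ob V) :
  cv_der_ar (cv_jac x y z) ;; (cv_dtr ⟦x, z⟧ y + cv_dtr x ⟦y, z⟧) ;;
    (⟪cv_dtr x z, 1_y⟫ + 1_⟦⟦x, z⟧, on_ob complex_der y⟧ +
     1_⟦on_ob complex_der x, ⟦y, z⟧⟧ +
     ⟪1_x, cv_dtr y z⟫) =
  cv_dtr ⟦x, y⟧ z ;; (⟪cv_dtr x y, 1_z⟫ + 1_⟦⟦x, y⟧, on_ob complex_der z⟧) ;;
    (cv_jac (on_ob complex_der x) y z + cv_jac x (on_ob complex_der y) z +
     cv_jac x y (on_ob complex_der z)).
Proof.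
have tgt_der_jac u v w : tgt (cv_der_ar (cv_jac u v w)) =
    th0 T (l00 A (l00 A u w) v) + th0 T (l00 A u (l00 A v w)).
  by rewrite tgt_cv_der tgt_cv_jac linearD.
pose E := (tgt_der_jac, tgt_cv_dtr, @cv_brk_tgt K A, @tgt_cv_jac K A).
apply: cv_ext; first by endpoints (complex_vect d) E.
rewrite !cv_comp2; [|endpoints (complex_vect d) E ..].
have e := th2_coherence T x y z.
rewrite /= ?(linear0, addr0, linear0r, linear0l, add0r).
rewrite linearNr !linearNl.
by apply: (zmod_comb (esym e)); zmod.
Qed.

Definition complex_derivation : two_derivation V :=
  @TwoDerivation K V complex_der cv_dtr (fun _ _ => erefl) tgt_cv_dtr
    cv_dtr_natural (fun _ _ => is_iso_arT _) cv_dtr_coherence.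

End ComplexDerivation.

Definition complex_leibder (K : fieldType) (A : sh_leibder K) : leibder2 K :=
  LeibDer2 (complex_derivation (sd_der A)).

(** * Strict isomorphisms and the counit *)

Section StrictMaps.
Context (K : fieldType).

(** The morphisms whose [f_2] and homotopy both vanish. *)
Record strict_map (A A' : sh_leibder K) (f0 : sh0 A -> sh0 A')
    (f1 : sh1 A -> sh1 A') : Prop := StrictMap {
  strict_dif : forall m, dif A' (f1 m) = f0 (dif A m);
  strict_l00 : forall x y, f0 (l00 A x y) = l00 A' (f0 x) (f0 y);
  strict_l01 : forall x m, f1 (l01 A x m) = l01 A' (f0 x) (f1 m);
  strict_l10 : forall m x, f1 (l10 A m x) = l10 A' (f1 m) (f0 x);
  strict_l3 : forall x y z, f1 (l3 x y z) = l3 (f0 x) (f0 y) (f0 z);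
  strict_th0 : forall x, f0 (th0 (sd_der A) x) = th0 (sd_der A') (f0 x);
  strict_th1 : forall m, f1 (th1 (sd_der A) m) = th1 (sd_der A') (f1 m);
  strict_th2 : forall x y,
    f1 (th2 (sd_der A) x y) = th2 (sd_der A') (f0 x) (f0 y)
}.

Lemma strict_map_inv (A A' : sh_leibder K) (f0 : sh0 A -> sh0 A')
    (f1 : sh1 A -> sh1 A') (g0 : sh0 A' -> sh0 A) (g1 : sh1 A' -> sh1 A) :
    cancel f0 g0 -> cancel g0 f0 -> cancel f1 g1 -> cancel g1 f1 ->
  strict_map f0 f1 -> strict_map g0 g1.
Proof.
move=> f0K g0K f1K g1K [sd s00 s01 s10 s3 st0 st1 st2].
by split=> *; (apply: (can_inj f0K) || apply: (can_inj f1K));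
  rewrite -?sd ?(s00, s01, s10, s3, st0, st1, st2) ?(g0K, g1K).
Qed.

Context (A A' : sh_leibder K).
Context (f0 : {linear sh0 A -> sh0 A'}) (f1 : {linear sh1 A -> sh1 A'}).
Hypothesis strictf : strict_map f0 f1.

Definition strict_alg_hom : sh_hom A A'.
Proof.
exists f0 f1 (bilinear_zero _ _ _) => /= [|x y|x m|m x|x y z];
  have [sd s00 s01 s10 s3 _ _ _] := strictf; first by [].
- by rewrite s00 subrr linear0.
- by rewrite s01 subrr.
- by rewrite s10 subrr.
- by rewrite s3 !linear0l !linear0r; zmod.
Defined.

Definition strict_hom : sh_leibder_hom A A'.
Proof.
exists strict_alg_hom (linear_zero _ _) => /= [x|m|x y];
  have [_ _ _ _ _ st0 st1 st2] := strictf.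
- by rewrite st0 subrr linear0.
- by rewrite st1 subrr.
- by rewrite st2 ?(linear0, linear0l, linear0r); zmod.
Defined.

End StrictMaps.

Lemma strict_homK (K : fieldType) (A A' : sh_leibder K)
    (f0 : {linear sh0 A -> sh0 A'}) (f1 : {linear sh1 A -> sh1 A'})
    (g0 : {linear sh0 A' -> sh0 A}) (g1 : {linear sh1 A' -> sh1 A})
    (sf : strict_map f0 f1) (sg : strict_map g0 g1) :
    cancel f0 g0 -> cancel f1 g1 ->
  sh_leibder_hom_comp (strict_hom sf) (strict_hom sg) = sh_leibder_hom_id A.
Proof.
move=> f0K f1K; apply: sh_leibder_hom_ext => //= [x y|x].
  by rewrite /sf2_comp_fun /= linear0 addr0.
by rewrite /= linear0 addr0.
Qed.

Section Counit.
Context (K : fieldType) (A : sh_leibder K).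
Local Notation V := (complex_leibder A).

Lemma arr_cv2 (f : tv_ar V) : (arr f).2 = f.2.
Proof. by rewrite arr.unlock /= subr0. Qed.

Lemma ker_cv1 (m : src_ker V) : (ker_ar m).1 = 0.
Proof. exact: (src_ker_ar m). Qed.

Fact counit1_linear : linear (fun m : src_ker V => (ker_ar m).2 : sh1 A).
Proof. by move=> a m n; rewrite (ker_ar_linear a). Qed.
Definition counit1 : {linear src_ker V -> sh1 A} := linear_pack counit1_linear.

Fact counit1V_linear :
  linear (fun m : sh1 A => ker_arr ((0, m) : tv_ar V)).
Proof.
move=> a m n; rewrite -linearP; congr ker_arr; congr pair.
by rewrite /= scaler0 addr0.
Qed.
Definition counit1V : {linear sh1 A -> src_ker V} :=
  linear_pack counit1V_linear.

Lemma counit1K : cancel counit1 counit1V.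
Proof.
move=> m; apply: ker_ar_inj; rewrite ker_arrK -(arr_ker_ar m); congr arr.
by rewrite -(ker_cv1 m) -surjective_pairing.
Qed.

Lemma counit1VK : cancel counit1V counit1.
Proof. by move=> m; rewrite /= arr_cv2. Qed.

(** The kernel of the source consists of the arrows [(0, m)], and [m] is what is
    kept of them.  The two signs, in [th2] of a normalized pair and in the
    transformation of a 2-derivation built from a complex, cancel. *)
Lemma counit_strict : @strict_map K (nc_leibder V) A idfun counit1.
Proof.
split=> //.
- by move=> m; rewrite -[RHS]tgt_ker /= ker_cv1 add0r.
- move=> x m; rewrite -[LHS]/(ker_ar (_ : src_ker V)).2 ker_ar_l01.
  by rewrite [LHS]cv_brk2 tgt_idar linear0l addr0.
- move=> m x; rewrite -[LHS]/(ker_ar (_ : src_ker V)).2 ker_ar_l10.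
  by rewrite [LHS]cv_brk2 linear0r add0r.
- by move=> x y z; rewrite -[LHS]/(arr (_ : tv_ar V)).2 arr_cv2.
- by move=> m; rewrite -[LHS]/(ker_ar (_ : src_ker V)).2 ker_ar_functor.
- move=> x y; rewrite -[LHS]/(ker_ar (_ : src_ker V)).2 ker_ar_bilinN /=.
  by rewrite arr_cv2 opprK.
Qed.

Lemma counitV_strict : @strict_map K A (nc_leibder V) idfun counit1V.
Proof.
refine (@strict_map_inv K (nc_leibder V) A idfun counit1 idfun counit1V
  _ _ counit1K counit1VK counit_strict) => //.
Qed.

Definition counit := strict_hom counit_strict.
Definition counitV := strict_hom counitV_strict.

End Counit.

Theorem theorem7p5 (K : fieldType) (charK0 : [pchar K] =i pred0) :
  equivalent_categories (LeibDer2_cat K) (TwoLeibDerInfty_cat K).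
Proof.
apply: (@equivalent_categories_ff_es _ _ (normalization K)
  (@lift_leibder_hom K) (@lift_leibder_homK K) (@nc_leibder_homK K)
  (@complex_leibder K) (@counit K) (@counitV K)) => A.
- by apply: strict_homK => // m; exact: counit1VK.
- by apply: strict_homK => // m; exact: counit1K.
Qed.
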